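(* Let $\lambda,\mu,\nu$ be partitions such that $|\lambda|+|\mu|+|\nu|\equiv0\pmod2$, and suppose that one of $\lambda,\mu,\nu$ is a single row or a single column. If $N_{k\mu,k\nu,k\lambda}>0$ for some integer $k\ge1$, then there exist partitions $\alpha,\beta,\gamma$ such that $$c^{k\mu}_{k\alpha,k\beta}\,c^{k\nu}_{k\alpha,k\gamma}\,c^{k\lambda}_{k\beta,k\gamma}>0.$$
   Context: For a partition $\lambda=(\lambda_1,\lambda_2,\ldots)$, $k\lambda=(k\lambda_1,k\lambda_2,\ldots)$ and $|\lambda|=\sum_i\lambda_i$. A single row is a partition $(t)$; a single column is a partition $(1^t)$ ($t$ parts equal to $1$). With $c_{\alpha,\beta}^{\mu}$ the Littlewood-Richardson coefficient ($s_\alpha s_\beta=\sum_\mu c_{\alpha,\beta}^\mu s_\mu$), the Newell-Littlewood number is $$N_{\mu,\nu,\lambda}=\sum_{\alpha,\beta,\gamma} c_{\alpha,\beta}^{\mu}c_{\alpha,\gamma}^{\nu}c_{\beta,\gamma}^{\lambda},$$ the sum over all triples of partitions (finitely many nonzero terms). *)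

(* Defs.v *)
From mathcomp Require Import all_boot all_order all_algebra.
From mathcomp Require Import finmap mpoly.
From mathcomp Require Import boolp classical_sets fsbigop.
Set Implicit Arguments.
Unset Strict Implicit.
Unset Printing Implicit Defensive.
Import Order.TTheory GRing.Theory Num.Theory.
Local Open Scope classical_set_scope.
Local Open Scope ring_scope.

(* Partitions are finite nonincreasing sequences of positive integers (no
   trailing zeros), so that equal partitions are equal sequences. *)
Definition is_part (la : seq nat) : bool := sorted geq la && (0%N \notin la).

(* For [k = 0] this is not a partition unless [la] is empty. *)
Definition scale (k : nat) (la : seq nat) : seq nat := [seq (k * i)%N | i <- la].

(* [(0)] is the empty partition, which is [nseq 0 1]: it is a column. *)
Definition single_row (la : seq nat) : Prop := exists t : nat, la = [:: t].
Definition single_column (la : seq nat) : Prop := exists t : nat, la = nseq t 1%N.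

Definition cell (la : seq nat) : finType :=
  {c : 'I_(size la) * 'I_(head 0%N la) | (c.2 < nth 0 la c.1)%N}.

Definition crow (la : seq nat) (c : cell la) : nat := (val c).1.
Definition ccol (la : seq nat) (c : cell la) : nat := (val c).2.

Definition semistandard (n : nat) (la : seq nat) (T : {ffun cell la -> 'I_n}) :
    bool :=
  [forall c : cell la, forall d : cell la,
     ((crow c == crow d) && (ccol c < ccol d)%N ==> (T c <= T d)%N) &&
     ((ccol c == ccol d) && (crow c < crow d)%N ==> (T c < T d)%N)].

Definition schur (n : nat) (la : seq nat) : {mpoly int[n]} :=
  \sum_(T : {ffun cell la -> 'I_n} | semistandard T) \prod_(c : cell la) 'X_(T c).

(* Finitely supported families [c] of integers, indexed by partitions, with
   s_al * s_be = \sum_mu c_mu s_mu.  An identity between symmetric functions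
   is an identity between the polynomials in [n] variables for every [n].
   Schur functions form a Z-basis of the ring of symmetric functions, so
   there is exactly one such family. *)
Definition schur_expansion (al be : seq nat) :
    set {fsfun seq nat -> int with 0} :=
  [set c | (forall mu, mu \in finsupp c -> is_part mu) /\
           (forall n : nat,
              schur n al * schur n be =
              \sum_(mu <- finsupp c) schur n mu *~ c mu)].

(* The Littlewood-Richardson coefficient c_{al,be}^{mu}; its nonnegativity
   is a theorem, not part of the definition. *)
Definition LR (al be mu : seq nat) : int :=
  (xget [fsfun] (schur_expansion al be)) mu.

(* [\sum_(t \in A)] is the sum of a finitely supported family. *)
Definition newell_littlewood (mu nu la : seq nat) : int :=
  \sum_(t \in [set t : seq nat * seq nat * seq nat |
                 [/\ is_part t.1.1, is_part t.1.2 & is_part t.2]])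
    (let: (al, be, ga) := t in LR al be mu * LR al ga nu * LR be ga la).

(* Main.v *)
Require Import Defs.
From mathcomp Require Import all_boot all_order all_algebra all_fingroup.
From mathcomp Require Import zify finmap mpoly.
From mathcomp Require boolp classical_sets fsbigop.
Set Implicit Arguments.
Unset Strict Implicit.
Unset Printing Implicit Defensive.
Import Order.TTheory GRing.Theory Num.Theory.
Local Open Scope ring_scope.

(** Since c_{al,be}^{mu} = c_{be,al}^{mu}, one may assume that la is the single
row or column.  A nonzero term of the Newell-Littlewood sum is a triple
al, be, ga for which the coefficients of k mu in s_al s_be, of k nu in
s_al s_ga and of k la in s_be s_ga are all nonzero.  Comparing sizes,
2 |al| = k (|mu| + |nu| - |la|), so the parity hypothesis gives |al| = k a for
an integer a.  Moreover al is squeezed row by row: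
  - if la is a row, then be and ga are rows, so k mu / al and k nu / al are
    horizontal strips and
    k max (mu_{i+1}, nu_{i+1}) <= al_i <= k min (mu_i, nu_i);
  - if la is a column of length t, then k la is a rectangle of width k, so be
    and ga have parts at most k and
    k (max (mu_i, nu_i) - 1) <= al_i <= k min (mu_i, nu_i).
In both cases k lo <= al <= k up for two partitions lo <= up, hence
|lo| <= a <= |up|.  An interval of the Young lattice contains partitions of all
intermediate sizes ([young_interval]), so there is al' of size a between lo and
up.  Then mu / al' and nu / al' are both horizontal (resp. vertical) strips; with
be' and ga' the rows (resp. columns) of the complementary sizes, the three
Littlewood-Richardson coefficients of the scaled triple are positive.

What has to be known about Littlewood-Richardson coefficients comes from the
bialternant formula V s_la = a_{la+rho}, where a_l is the alternant
det (x_i ^ l_j), rho = (n-1, ..., 1, 0) and V = a_rho.  It is proved by induction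
on n: removing the entries n from a tableau is the same recursion
([tableau_sum_rec]) as the one that column operations give for alternants
([alternant_rec]).  It makes Schur polynomials symmetric and V s_al s_be
alternating, hence a combination of the a_{nu+rho}; therefore s_al s_be expands
in Schur polynomials ([expansion_exists]), compatibly with the restriction to
fewer variables ([restr_expands]), and the coefficient of s_nu is
    [x^{nu+rho}] a_{al+rho} s_be
       = sum over permutations w of sgn(w) [x^{nu+rho-w(al+rho)}] s_be
([LR_coef], [mcoeff_alternantM]).  If this is nonzero, then some w contributes,
which gives the size identity and the bounds al_i <= nu_i <= al_i + be_1
([LR_bounds]).  If be is a row, all its monomials of the right degree have
coefficient 1 and the sum is the determinant of the 0-1 matrix of the relation
al_j + rho_j <= nu_i + rho_i, which vanishes unless nu / al is a horizontal strip
([LR_row_strip]).  Conversely, for the strips used above only w = 1 contributes,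
and it contributes a positive number of tableaux ([LR_row_pos], [LR_rect_pos]). *)

(** * Alternants and their recursion on the number of variables *)

Section Alternants.
Variables (R : comNzRingType) (x : nat -> R).

(** The generalized Vandermonde determinant det (x_i ^ l_j), for i, j < n.
Variables and exponents are indexed by [nat], so that n can vary. *)
Definition alternant (n : nat) (l : nat -> nat) : R :=
  \det (\matrix_(i < n, j < n) x i ^+ l j).

(** [f] gives the n rows of a shape interlacing with the n+1 rows of [mu]; the
bound [B] only serves to make the set of such shapes finite. *)
Definition interlacing (n B : nat) (mu : nat -> nat) (f : {ffun 'I_n -> 'I_B}) :=
  [forall j : 'I_n, (mu j.+1 <= f j <= mu j)%N].

(** The row lengths of [f] as a function on [nat], zero from row n on. *)
Definition ffun_nat (n B : nat) (f : {ffun 'I_n -> 'I_B}) (j : nat) : nat :=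
  oapp (fun i => f i : nat) 0%N (insub j).

Lemma ffun_natE n B (f : {ffun 'I_n -> 'I_B}) (j : 'I_n) : ffun_nat f j = f j.
Proof. by rewrite /ffun_nat valK. Qed.

Lemma ffun_nat_ge n B (f : {ffun 'I_n -> 'I_B}) j : (n <= j)%N -> ffun_nat f j = 0%N.
Proof. by move=> le_nj; rewrite /ffun_nat insubF //= ltnNge le_nj. Qed.

Lemma geom_sum_range (u v : R) (B a b : nat) : (a <= b < B)%N ->
  u ^+ b.+1 - u ^+ a * v ^+ (b.+1 - a) =
  (u - v) * \sum_(p < B | (a <= p <= b)%N) u ^+ p * v ^+ (b - p).
Proof.
case/andP=> le_ab lt_bB.
have -> : \sum_(p < B | (a <= p <= b)%N) u ^+ p * v ^+ (b - p) =
          u ^+ a * \sum_(i < b.+1 - a) u ^+ i * v ^+ ((b.+1 - a).-1 - i).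
  rewrite mulr_sumr.
  transitivity (\sum_(a <= p < b.+1) u ^+ p * v ^+ (b - p)).
    rewrite (big_nat_widen _ _ B) // (big_nat_widenl _ 0%N) //= big_mkord.
    by apply: eq_bigl => i; rewrite ltnS andbC.
  rewrite -{1}[a]add0n big_addn big_mkord; apply: eq_bigr => i _.
  rewrite addnC exprD mulrA; congr (_ * v ^+ _).
  by rewrite subnDA; congr (_ - _)%N; rewrite (subSn le_ab).
have /subnKC e : (a <= b.+1)%N by rewrite leqW.
rewrite -{1}e exprD -mulrBr -opprB subrXX -mulNr opprB mulrCA.
congr (_ * (_ * _)); apply: eq_bigr => i _; by rewrite mulrC.
Qed.

(** The exponents are mu + rho.  Subtracting from each column a multiple of the
next one clears the last row but for its last entry, and every other entry is
divisible by x_i - x_n with quotient a geometric sum.  Expanding the determinant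
of these sums multilinearly gives one alternant for each shape interlacing
with mu. *)
Lemma alternant_rec (n B : nat) (mu : nat -> nat) :
  (forall j, (j < n)%N -> (mu j.+1 <= mu j < B)%N) ->
  alternant n.+1 (fun j => mu j + (n - j))%N =
  (\prod_(i < n) (x i - x n)) *
  \sum_(f : {ffun 'I_n -> 'I_B} | interlacing mu f)
     x n ^+ (mu n + \sum_(j < n) (mu j - f j))%N *
     alternant n (fun j => ffun_nat f j + (n.-1 - j))%N.
Proof.
move=> mu_ni.
(* A *m U subtracts x_n ^ (l_j - l_{j+1}) times column j+1 from column j. *)
pose U : 'M[R]_n.+1 := \matrix_(i, j)
  ((i == j)%:R - (i == j.+1 :> nat)%:R * x n ^+ (mu j - mu j.+1).+1).
have detU : \det U = 1.
  rewrite det_trig; last first.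
    apply/is_trig_mxP => i j lt_ij; rewrite mxE.
    rewrite -val_eqE /= (ltn_eqF lt_ij) ltn_eqF ?mul0r ?subr0 //.
    by rewrite (leq_trans lt_ij).
  apply: big1 => i _; rewrite mxE eqxx.
  by rewrite ltn_eqF // mul0r subr0.
rewrite /alternant; set A := \matrix_(i, j) _.
rewrite -[LHS](_ : \det (A *m U) = _); last by rewrite det_mulmx detU mulr1.
have AUE i (j : 'I_n.+1) (lt_jn : (j < n)%N) :
    (A *m U) i j = x i ^+ (mu j + (n - j))
      - x i ^+ (mu j.+1 + (n - j.+1)) * x n ^+ (mu j - mu j.+1).+1.
  have lt_j1 : (j.+1 < n.+1)%N by [].
  rewrite mxE (bigD1 j) //= (bigD1 (Ordinal lt_j1)) /=; last first.
    by rewrite -val_eqE /= gtn_eqF.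
  rewrite big1 ?addr0; last first.
    move=> i' /andP[ne1 ne2]; rewrite !mxE (negPf ne1).
    by move: ne2; rewrite -val_eqE /= => /negPf ->; rewrite mul0r subr0 mulr0.
  rewrite !mxE eqxx ltn_eqF // mul0r subr0 mulr1 -val_eqE /= gtn_eqF // eqxx.
  by rewrite sub0r mul1r mulrN.
have AUm i : (A *m U) i ord_max = x i ^+ mu n.
  rewrite mxE (bigD1 ord_max) //= big1 ?addr0.
    by rewrite !mxE eqxx ltn_eqF // mul0r subr0 mulr1 subnn addn0.
  move=> i' ne; rewrite !mxE (negPf ne) ltn_eqF ?mul0r ?subr0 ?mulr0 //=.
rewrite (expand_det_row _ ord_max) big_ord_recr /= big1 ?add0r; last first.
  move=> i _; rewrite AUE //=.
  have /andP[le_mu _] := mu_ni i (ltn_ord i).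
  rewrite -exprD.
  have -> : (mu i.+1 + (n - i.+1) + (mu i - mu i.+1).+1 = mu i + (n - i))%N.
    by have := ltn_ord i; lia.
  by rewrite subrr mul0r.
rewrite AUm /cofactor /= addnn -mul2n exprM sqrrN !expr1n mul1r.
pose G : 'M[R]_n := \matrix_(i, j) \sum_(p < B | (mu j.+1 <= p <= mu j)%N)
   x i ^+ (p + (n.-1 - j)) * x n ^+ (mu j - p).
have -> : row' ord_max (col' ord_max (A *m U)) =
   diag_mx (\row_(i < n) (x i - x n)) *m G.
  apply/matrixP => i j; rewrite mul_diag_mx [RHS]mxE [_ 0 i]mxE [G i j]mxE [LHS]mxE [LHS]mxE.
  have -> : lift ord_max i = widen_ord (leqnSn n) i by apply/val_inj/lift_max.
  have -> : lift ord_max j = widen_ord (leqnSn n) j by apply/val_inj/lift_max.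
  rewrite AUE //=.
  have /andP[le_mu lt_B] := mu_ni j (ltn_ord j).
  have rg : (mu j.+1 <= mu j < B)%N by rewrite le_mu.
  have := geom_sum_range (x i) (x n) rg.
  move/(congr1 (fun y => x i ^+ (n.-1 - j) * y)).
  have -> : (n.-1 - j = n - j.+1)%N by rewrite -subn1 -subnDA add1n.
  rewrite mulrBr -exprD mulrCA mulr_sumr mulrA -exprD (subSn le_mu).
  have -> : (n - j.+1 + (mu j).+1 = mu j + (n - j))%N.
    by have := ltn_ord j; lia.
  move=> ->; rewrite -mulr_sumr mulrCA; congr (_ * _); rewrite mulr_sumr.
  by apply: eq_bigr => p _; rewrite mulrA -exprD addnC.
rewrite det_mulmx det_diag mulrCA; congr (_ * _).
  by apply: eq_bigr => i _; rewrite mxE.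
rewrite -(det_tr G).
under [RHS]eq_bigr do rewrite -det_tr.
rewrite /determinant.
have step (s : 'S_n) : \prod_i G^T i (s i) =
  \sum_(f : {ffun 'I_n -> 'I_B} | interlacing mu f)
     \prod_(i < n) (x (s i) ^+ (f i + (n.-1 - i)) * x n ^+ (mu i - f i)).
  transitivity (\prod_(i < n) \sum_(p < B | (mu i.+1 <= p <= mu i)%N)
     (x (s i) ^+ (p + (n.-1 - i)) * x n ^+ (mu i - p))).
    by apply: eq_bigr => i _; rewrite !mxE.
  rewrite (bigA_distr_big_dep _ (fun (i : 'I_n) (p : 'I_B) =>
    (x (s i) ^+ (p + (n.-1 - i)) * x n ^+ (mu i - p)))).
  apply: eq_bigl => f; apply/familyP/forallP => h i; first by have := h i.
  by exact: h i.
transitivity (\sum_(s : 'S_n) \sum_(f : {ffun 'I_n -> 'I_B} | interlacing mu f)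
   x n ^+ mu n * ((-1) ^+ s *
     \prod_(i < n) (x (s i) ^+ (f i + (n.-1 - i)) * x n ^+ (mu i - f i)))).
  rewrite mulr_sumr; apply: eq_bigr => s _; rewrite -mulr_sumr -mulr_sumr.
  by congr (_ * (_ * _)); exact: step.
rewrite exchange_big /=; apply: eq_bigr => f _.
rewrite mulr_sumr; apply: eq_bigr => s _.
rewrite big_split /= exprD prodrXr.
rewrite mulrCA [in RHS]mulrCA; congr (_ * _).
rewrite -mulrA; congr (_ * _); rewrite mulrC; congr (_ * _).
by apply: eq_bigr => i _; rewrite !mxE ffun_natE.
Qed.

End Alternants.

(** * Branching rule for semistandard tableaux *)

(** The first failure of a downward closed predicate tells where it holds. *)
Lemma find_predC_iota (P : pred nat) (m i : nat) :
  (forall a b, (a <= b < m)%N -> P b -> P a) ->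
  (i < m)%N -> (i < find (predC P) (iota 0 m))%N = P i.
Proof.
move=> dcl lt_im; apply/idP/idP => [lt_if|Pi].
  by have := before_find 0%N lt_if; rewrite nth_iota //= => /negbFE.
rewrite ltnNge; apply/negP => le_fi.
have lt_fm : (find (predC P) (iota 0 m) < m)%N by apply: leq_ltn_trans lt_im.
have hasP : has (predC P) (iota 0 m) by rewrite has_find size_iota.
have := nth_find 0%N hasP; rewrite nth_iota //= add0n => /negP; apply.
by apply: (dcl _ i) => //; rewrite le_fi.
Qed.

Section Tableaux.
Variables (C : finType) (row col : C -> nat).
Hypothesis row_col_inj : forall c d, row c = row d -> col c = col d -> c = d.
Variables (R : comNzRingType) (x : nat -> R) (N : nat).

(** Tableaux are studied on an arbitrary finite set [C] of cells with a row and a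
column index: all the shapes of an iterated branching then live in a single
type, that of the cells of the initial shape.  [inside mu c] says that [c] is a
cell of the shape [mu], given by its row lengths. *)
Definition inside (mu : nat -> nat) (c : C) := (col c < mu (row c))%N.

(** All the cells of the Young diagram of [mu] are present in [C]. *)
Definition full_shape (mu : nat -> nat) := forall i j : nat, (j < mu i)%N ->
  exists2 c, row c = i & col c = j.

(** Semistandard tableaux of shape [mu] with entries less than [n]; outside [mu]
the filling is fixed to [ord0], so that it carries no information. *)
Definition bounded_tableau (n : nat) (mu : nat -> nat) (T : {ffun C -> 'I_N.+1}) :=
  [forall c, if inside mu c then (T c < n)%N else T c == ord0] &&
  [forall c, forall d, inside mu c && inside mu d ==>
     ((row c == row d) && (col c < col d)%N ==> (T c <= T d)%N) &&
     ((col c == col d) && (row c < row d)%N ==> (T c < T d)%N)].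

(** The Schur polynomial of shape [mu] in x_0, ..., x_{n-1}. *)
Definition tableau_sum (n : nat) (mu : nat -> nat) : R :=
  \sum_(T | bounded_tableau n mu T) \prod_(c | inside mu c) x (T c).

Lemma bounded_tableauP n mu (T : {ffun C -> 'I_N.+1}) :
  reflect [/\ forall c, inside mu c -> (T c < n)%N,
              forall c, ~~ inside mu c -> T c = ord0,
              forall c d, inside mu c -> inside mu d -> row c = row d ->
                (col c < col d)%N -> (T c <= T d)%N &
              forall c d, inside mu c -> inside mu d -> col c = col d ->
                (row c < row d)%N -> (T c < T d)%N]
          (bounded_tableau n mu T).
Proof.
apply: (iffP andP) => [[/forallP h1 /forallP h2]|[h1 h2 h3 h4]].
  split=> [c ic|c /negPf nic|c d ic id e lt|c d ic id e lt].
  - by have := h1 c; rewrite ic.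
  - by have := h1 c; rewrite nic => /eqP.
  - by have /forallP/(_ d) := h2 c; rewrite ic id e eqxx lt /= => /andP[].
  - by have /forallP/(_ d) := h2 c; rewrite ic id e eqxx lt /= => /andP[].
split; apply/forallP => c.
  by case: ifPn => [/h1|/h2 ->].
apply/forallP => d; apply/implyP => /andP[ic id].
by apply/andP; split; apply/implyP => /andP[/eqP e lt]; [apply: h3|apply: h4].
Qed.

Lemma card_inside m mu : full_shape mu -> (forall j, (m <= j)%N -> mu j = 0%N) ->
  #|inside mu| = (\sum_(j < m) mu j)%N.
Proof.
move=> fmu mu0; rewrite -sum1_card.
have ltm c : inside mu c -> (row c < m)%N.
  by rewrite /inside; case: (ltnP (row c) m) => // /mu0 ->; rewrite ltn0.
case: m mu0 ltm => [|m] mu0 ltm.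
  by rewrite big_ord0 big_pred0 // => c; apply/negP => /ltm.
rewrite (partition_big (fun c => inord (row c) : 'I_m.+1) xpredT) //=.
apply: eq_bigr => j _; rewrite sum1_card cardE -(size_map col) -[RHS](size_iota 0).
apply: perm_size; apply: uniq_perm; rewrite ?iota_uniq //.
  rewrite map_inj_in_uniq ?enum_uniq // => c d.
  rewrite !mem_enum /in_mem /= => /andP[ic /eqP ec] /andP[id /eqP ed].
  apply: row_col_inj.
  by move: ec; rewrite -ed => /(congr1 val) /=; rewrite !inordK // ltm.
move=> i; rewrite mem_iota add0n leq0n /=.
apply/mapP/idP => [[c]|lt_i].
  rewrite mem_enum /in_mem /= => /andP[ic /eqP <-] ->.
  by rewrite inordK ?ltm.
have [c rc cc] := fmu _ _ lt_i; exists c => //.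
rewrite mem_enum /in_mem /= /inside rc cc lt_i /= -rc.
by apply/eqP/val_inj; rewrite /= inordK // rc.
Qed.

Lemma tableau_ge_row n mu T : full_shape mu -> (forall j, (mu j.+1 <= mu j)%N) ->
  bounded_tableau n mu T -> forall c, inside mu c -> (row c <= T c)%N.
Proof.
move=> fmu ni /bounded_tableauP[_ _ _ h] c.
move e: (row c) => i; elim: i c e => [//|i IH] c rc ic.
have ld : (col c < mu i)%N by apply: leq_trans (ni i); rewrite -rc.
have [d rd cd] := fmu _ _ ld.
have id : inside mu d by rewrite /inside rd cd.
by apply: leq_ltn_trans (IH d rd id) _; apply: h; rewrite ?rd ?rc.
Qed.

Lemma tableau_sum0 mu : (forall j, mu j = 0%N) -> tableau_sum 0 mu = 1.
Proof.
move=> mu0; have ni c : inside mu c = false by rewrite /inside mu0.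
rewrite /tableau_sum (big_pred1 [ffun=> ord0]).
  by rewrite big_pred0.
move=> T; apply/bounded_tableauP/eqP => [[_ h _ _]|->].
  by apply/ffunP => c; rewrite ffunE h // ni.
by split=> c; rewrite ?ni ?ffunE.
Qed.

Section Branching.
Variables (n B : nat) (mu : nat -> nat).
Hypothesis lt_nN : (n < N.+1)%N.
Hypothesis mu_full : full_shape mu.
Hypothesis mu_ni : forall j, (mu j.+1 <= mu j)%N.
Hypothesis mu_B : forall j, (mu j < B.+1)%N.
Hypothesis mu_n : forall j, (n < j)%N -> mu j = 0%N.

(** The cell in row [j] and column [i] has an entry less than [n]. *)
Definition low (T : {ffun C -> 'I_N.+1}) (j i : nat) :=
  [exists c, [&& row c == j, col c == i & (T c < n)%N]].

(** The shape formed by the entries of [T] less than [n], row by row. *)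
Definition subshape (T : {ffun C -> 'I_N.+1}) : {ffun 'I_n -> 'I_B.+1} :=
  [ffun j : 'I_n => inord (find (predC (low T j)) (iota 0 (mu j)))].

Lemma lowE T c : low T (row c) (col c) = (T c < n)%N.
Proof.
apply/existsP/idP => [[d /and3P[/eqP er /eqP ec lt]]|lt].
  by rewrite -(row_col_inj er ec).
by exists c; rewrite !eqxx.
Qed.

Lemma subshape_le T (j : 'I_n) : (subshape T j <= mu j)%N.
Proof.
have le : (find (predC (low T j)) (iota 0 (mu j)) <= mu j)%N.
  by apply: leq_trans (find_size _ _) _; rewrite size_iota.
by rewrite ffunE inordK // (leq_ltn_trans le).
Qed.

Lemma subshapeE T (j : 'I_n) i : bounded_tableau n.+1 mu T -> (i < mu j)%N ->
  (i < subshape T j)%N = low T j i.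
Proof.
move=> /bounded_tableauP[_ _ h _] lt_i.
rewrite ffunE inordK; last first.
  apply: leq_ltn_trans (mu_B j).
  by apply: leq_trans (find_size _ _) _; rewrite size_iota.
apply: find_predC_iota => // a b /andP[le_ab lt_b] /existsP[d /and3P[/eqP rd /eqP cd lt]].
have lt_a : (a < mu j)%N by apply: leq_ltn_trans lt_b.
have [c rc cc] := mu_full lt_a.
apply/existsP; exists c; rewrite rc cc !eqxx /=.
move: le_ab; rewrite leq_eqVlt => /orP[/eqP e|lt_ab].
  by rewrite (row_col_inj (c := c) (d := d)) ?rc ?rd ?cc ?cd.
by apply: leq_ltn_trans lt; apply: h; rewrite /inside ?rc ?rd ?cc ?cd.
Qed.

Lemma insideS T c : bounded_tableau n.+1 mu T -> inside mu c ->
  inside (ffun_nat (subshape T)) c = (T c < n)%N.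
Proof.
move=> hT ic; rewrite /inside; case: (ltnP (row c) n) => [lt|le].
  rewrite -[X in ffun_nat _ X]/(nat_of_ord (Ordinal lt)) ffun_natE.
  by rewrite subshapeE //= lowE.
rewrite ffun_nat_ge // ltn0; apply/esym/negbTE; rewrite -leqNgt.
by apply: leq_trans le _; apply: tableau_ge_row hT _ _.
Qed.

Lemma subshape_interlacing T : bounded_tableau n.+1 mu T -> interlacing mu (subshape T).
Proof.
move=> hT; apply/forallP => j; rewrite subshape_le andbT leqNgt; apply/negP => lt.
have lt' := leq_trans lt (mu_ni j).
have [c rc cc] := mu_full lt'; have [d rd cd] := mu_full lt.
have := subshapeE hT lt'; rewrite ltnn -{1}rc -cc lowE => /esym/negbT.
rewrite -leqNgt => le_n.
case/bounded_tableauP: hT => h1 _ _ h4.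
have id : inside mu d by rewrite /inside rd cd.
have : (T c < T d)%N by apply: h4; rewrite /inside ?rc ?cc ?rd ?cd.
by have := h1 d id; lia.
Qed.

Variable f : {ffun 'I_n -> 'I_B.+1}.
Hypothesis f_int : interlacing mu f.

Let nu := ffun_nat f.

Lemma nu_le j : (nu j <= mu j)%N.
Proof.
case: (ltnP j n) => [lt|le]; last by rewrite /nu ffun_nat_ge.
by have /forallP/(_ (Ordinal lt))/andP[_] := f_int; rewrite -ffun_natE.
Qed.

Lemma nu_ge j : (j < n)%N -> (mu j.+1 <= nu j)%N.
Proof.
by move=> lt; have /forallP/(_ (Ordinal lt))/andP[] := f_int; rewrite -ffun_natE.
Qed.

Lemma inside_nu c : inside nu c -> inside mu c.
Proof. by move=> lt; apply: leq_trans lt (nu_le _). Qed.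

(** Filling the strip between [nu] and [mu] with the letter [n], and the inverse
operation of erasing that letter. *)
Definition extend_tableau (T : {ffun C -> 'I_N.+1}) : {ffun C -> 'I_N.+1} :=
  [ffun c => if inside nu c then T c else if inside mu c then inord n else ord0].
Definition restrict_tableau (T : {ffun C -> 'I_N.+1}) : {ffun C -> 'I_N.+1} :=
  [ffun c => if inside nu c then T c else ord0].

Lemma extend_restrict T : bounded_tableau n.+1 mu T -> subshape T = f ->
  extend_tableau (restrict_tableau T) = T.
Proof.
move=> hT ef; apply/ffunP => c; rewrite !ffunE.
case: (boolP (inside nu c)) => [//|ni]; case/bounded_tableauP: (hT) => h1 h2 _ _.
case: ifPn => [ic|/h2 ->//].
have := insideS hT ic; rewrite ef -/nu (negPf ni) => /esym/negbT.
rewrite -leqNgt => le; apply/val_inj; rewrite /= inordK //.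
by have := h1 c ic; lia.
Qed.

Lemma extend_bounded T : bounded_tableau n nu T ->
  bounded_tableau n.+1 mu (extend_tableau T).
Proof.
case/bounded_tableauP => h1 h2 h3 h4; apply/bounded_tableauP; split.
- move=> c ic; rewrite ffunE ic; case: ifPn => [/h1 lt|_]; first exact: leqW.
  by rewrite inordK.
- move=> c ni; rewrite ffunE (negPf ni) ifN //.
  by apply: contra ni; apply: inside_nu.
- move=> c d ic id er lt; rewrite !ffunE ic id.
  case: (boolP (inside nu d)) => [jd|nd].
    have jc : inside nu c by rewrite /inside er (ltn_trans lt).
    by rewrite jc; apply: h3.
  by case: ifPn => [/h1 /ltnW|_]; rewrite inordK.
- move=> c d ic id ec lt; rewrite !ffunE ic id.
  have lt_n : (row c < n)%N.
    apply: (leq_trans lt); rewrite leqNgt; apply/negP => /mu_n e.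
    by move: id; rewrite /inside e.
  have jc : inside nu c.
    rewrite /inside ec; apply: leq_trans (nu_ge lt_n).
    apply: (leq_trans id); move: lt; elim: (row d) => // m IH.
    rewrite ltnS leq_eqVlt => /orP[/eqP -> //|/IH]; exact: leq_trans.
  rewrite jc; case: ifPn => [jd|_]; first exact: h4.
  by rewrite inordK // h1.
Qed.

Lemma subshape_extend T : bounded_tableau n nu T -> subshape (extend_tableau T) = f.
Proof.
move=> hT; have hE := extend_bounded hT.
have key c : inside mu c -> (extend_tableau T c < n)%N = inside nu c.
  move=> ic; rewrite ffunE ic; case: ifPn => [jc|_]; last by rewrite inordK // ltnn.
  by case/bounded_tableauP: hT => /(_ c jc).
apply/ffunP => j; apply/val_inj/eqP; rewrite eqn_leq /=; apply/andP; split.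
  rewrite leqNgt; apply/negP => lt; have lt' := leq_trans lt (subshape_le _ _).
  have [c rc cc] := mu_full lt'.
  move: lt; rewrite subshapeE // -{1}rc -cc lowE key; last by rewrite /inside rc cc.
  by rewrite /inside rc cc /nu ffun_natE ltnn.
rewrite leqNgt; apply/negP => lt.
have lt' : (subshape (extend_tableau T) j < mu j)%N.
  by apply: (leq_trans lt); have := nu_le j; rewrite /nu ffun_natE.
have [c rc cc] := mu_full lt'.
have := subshapeE hE lt'; rewrite ltnn -{1}rc -cc lowE key; last by rewrite /inside rc cc.
by rewrite /inside rc cc /nu ffun_natE lt.
Qed.

Lemma sum_fixed_subshape :
  \sum_(T | bounded_tableau n.+1 mu T && (subshape T == f))
     \prod_(c | inside mu c) x (T c) =
  x n ^+ (mu n + \sum_(j < n) (mu j - f j))%N * tableau_sum n nu.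
Proof.
(* Erasing the letter n is a bijection onto the tableaux of shape nu. *)
rewrite (reindex_onto extend_tableau restrict_tableau) /=; last first.
  by move=> T /andP[hT /eqP]; apply: extend_restrict.
rewrite mulr_sumr; apply: eq_big => T.
  apply/idP/idP => [|hT].
    case/andP => /andP[hE /eqP ef] /eqP eT.
    case/bounded_tableauP: (hE) => h1 h2 h3 h4.
    have eE c : inside nu c -> T c = extend_tableau T c by rewrite ffunE => ->.
    apply/bounded_tableauP; split.
    - move=> c jc; rewrite eE // -insideS // ?ef //; exact: inside_nu.
    - by move=> c nc; rewrite -eT ffunE (negPf nc).
    - by move=> c d jc jd er lt; rewrite !eE //; apply: h3 => //; apply: inside_nu.
    - by move=> c d jc jd er lt; rewrite !eE //; apply: h4 => //; apply: inside_nu.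
  rewrite extend_bounded // subshape_extend // eqxx /=.
  apply/eqP/ffunP => c; rewrite !ffunE; case: (boolP (inside nu c)) => [//|nc].
  by case/bounded_tableauP: hT => _ h _ _; rewrite h.
move=> _; rewrite (bigID (inside nu)) /= mulrC; congr (_ * _).
  rewrite (eq_bigr (fun _ => x n)); last first.
    by move=> c /andP[ic nc]; rewrite ffunE (negPf nc) ic inordK.
  rewrite prodr_const; congr (_ ^+ _).
  have nu_full : full_shape nu.
    by move=> i j lt; apply: mu_full; apply: leq_trans (nu_le i).
  have c1 := @card_inside n.+1 mu mu_full mu_n.
  have c2 := @card_inside n nu nu_full (fun j => @ffun_nat_ge n B.+1 f j).
  have c3 : #|inside mu| = (#|inside nu| + #|[pred c | inside mu c & ~~ inside nu c]|)%N.
    rewrite -!sum1_card (bigID (inside nu)) /=; congr (_ + _)%N.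
    apply: eq_bigl => c; rewrite /in_mem /=.
    by apply/andP/idP => [[]//|jc]; split=> //; apply: inside_nu.
  have c4 : (\sum_(j < n) mu j = \sum_(j < n) (mu j - f j) + \sum_(j < n) nu j)%N.
    rewrite -big_split /=; apply: eq_bigr => j _.
    by have := nu_le j; rewrite /nu ffun_natE => /subnK.
  transitivity #|[pred c | inside mu c & ~~ inside nu c]|; first exact: eq_card.
  apply/(@addnI (\sum_(j < n) nu j)%N); rewrite -c2 -c3 c1 big_ord_recr /= c4 c2.
  by rewrite addnAC [LHS]addnC [X in (_ + X)%N = _]addnC.
apply: eq_big => c.
  by apply/andP/idP => [[]//|jc]; split=> //; apply: inside_nu.
by case/andP => _ jc; rewrite ffunE jc.
Qed.

End Branching.

(** A tableau with entries at most n amounts to the shape of its entries less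
than n, which interlaces with [mu], and a tableau of that shape: the other
cells all contain n. *)
Theorem tableau_sum_rec n B mu : (n < N.+1)%N -> full_shape mu ->
  (forall j, (mu j.+1 <= mu j)%N) -> (forall j, (mu j < B.+1)%N) ->
  (forall j, (n < j)%N -> mu j = 0%N) ->
  tableau_sum n.+1 mu = \sum_(f : {ffun 'I_n -> 'I_B.+1} | interlacing mu f)
     x n ^+ (mu n + \sum_(j < n) (mu j - f j))%N * tableau_sum n (ffun_nat f).
Proof.
move=> lt_n fmu ni hB h0.
rewrite /tableau_sum (partition_big (subshape n B mu) (fun f => interlacing mu f));
  last by move=> T; exact: subshape_interlacing.
by apply: eq_bigr => f hf; apply: sum_fixed_subshape.
Qed.

(** The bialternant formula.  The case mu = 0 of [alternant_rec] provides the
recursion of the Vandermonde determinant itself. *)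
Theorem tableau_sum_alternant n mu : (n <= N.+1)%N -> full_shape mu ->
  (forall j, (mu j.+1 <= mu j)%N) -> (forall j, (n <= j)%N -> mu j = 0%N) ->
  tableau_sum n mu * alternant x n (fun j => n.-1 - j)%N =
  alternant x n (fun j => mu j + (n.-1 - j))%N.
Proof.
elim: n mu => [|n IH] mu le_n fmu ni mu0.
  rewrite tableau_sum0; last by move=> j; apply: mu0.
  by rewrite /alternant !det_mx00 mulr1.
have muB j : (mu j < (mu 0%N).+1)%N.
  by rewrite ltnS; elim: j => // j; apply: leq_trans.
rewrite (@alternant_rec _ x n (mu 0%N).+1 mu); last by move=> j _; rewrite ni muB.
have -> : alternant x n.+1 (fun j => n.+1.-1 - j)%N =
  \prod_(i < n) (x i - x n) * alternant x n (fun j => n.-1 - j)%N.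
  (* Only the zero shape interlaces with the zero shape. *)
  have := @alternant_rec _ x n 1 (fun _ => 0%N) (fun _ _ => isT).
  rewrite (eq_bigl (pred1 [ffun=> ord0])); last first.
    move=> f; apply/forallP/eqP => [h|-> j]; last by rewrite ffunE.
    by apply/ffunP => j; rewrite ffunE; apply/val_inj/eqP; have := h j; rewrite leqn0.
  rewrite big_pred1_eq [X in x n ^+ X]big1 ?expr0 ?mul1r => [|j _]; last by rewrite ffunE.
  move=> e; apply: etrans e _; congr (_ * _); rewrite /alternant; congr (\det _).
  by apply/matrixP => i j; rewrite !mxE ffun_natE ffunE.
rewrite (@tableau_sum_rec n (mu 0%N)) //.
rewrite mulrCA; congr (_ * _); rewrite mulr_suml.
apply: eq_bigr => f hf; rewrite -mulrA; congr (_ * _).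
apply: IH => [|i j lt|j|j]; first exact: ltnW.
- by apply: fmu; apply: leq_trans (nu_le hf i).
- case: (ltnP j.+1 n) => [lt|le]; last by rewrite ffun_nat_ge.
  by apply: leq_trans (nu_le hf _) _; apply: (nu_ge hf); apply: ltnW.
- exact: ffun_nat_ge.
Qed.

End Tableaux.

(** * Partitions, Schur polynomials and the bialternant formula *)

Lemma nth_part_noninc (la : seq nat) (i j : nat) : is_part la -> (i <= j)%N ->
  (nth 0 la j <= nth 0 la i)%N.
Proof.
case/andP => so _ le_ij; case: (ltnP j (size la)) => [lt|ge]; last first.
  by rewrite (nth_default _ ge).
have := @sorted_leq_nth _ geq (fun a b c h1 h2 => leq_trans h2 h1) leqnn 0%N _ so i j.
by apply=> //; rewrite inE ?lt // (leq_ltn_trans le_ij).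
Qed.

Lemma nth_part_gt0 (la : seq nat) (i : nat) : is_part la ->
  (0 < nth 0 la i)%N = (i < size la)%N.
Proof.
case/andP => _ no0; case: (ltnP i (size la)) => [lt|ge]; last by rewrite nth_default.
by rewrite lt0n; apply: contra no0 => /eqP <-; apply: mem_nth.
Qed.

Lemma part_eq (la mu : seq nat) : is_part la -> is_part mu ->
  nth 0%N la =1 nth 0%N mu -> la = mu.
Proof.
move=> pl pm e.
have es : size la = size mu.
  apply/eqP; rewrite eqn_leq; apply/andP; split; rewrite leqNgt; apply/negP.
    by rewrite -nth_part_gt0 // e nth_part_gt0 // ltnn.
  by rewrite -nth_part_gt0 // -e nth_part_gt0 // ltnn.
by apply: (@eq_from_nth _ 0%N) => // i _; apply: e.
Qed.

Lemma sumn_nth (s : seq nat) (n : nat) : (size s <= n)%N ->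
  sumn s = (\sum_(i < n) nth 0 s i)%N.
Proof.
elim: s n => [|a s IH] [|n] //= le.
- by rewrite big_ord0.
- by rewrite big1 // => i _; rewrite nth_nil.
by rewrite big_ord_recl /= (IH n).
Qed.

Lemma size_part_le (la : seq nat) : is_part la -> (size la <= sumn la)%N.
Proof.
move=> pl; rewrite (@sumn_nth la (size la)) // -{1}(card_ord (size la)) -sum1_card.
by apply: leq_sum => i _; rewrite nth_part_gt0.
Qed.

Lemma scale_nth k (la : seq nat) i : nth 0%N (scale k la) i = (k * nth 0 la i)%N.
Proof.
case: (ltnP i (size la)) => [lt|ge]; first by rewrite (nth_map 0%N).
by rewrite !nth_default ?muln0 // size_map.
Qed.

Lemma scale_part k (la : seq nat) : (0 < k)%N -> is_part la -> is_part (scale k la).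
Proof.
move=> k0 /andP[so no0]; apply/andP; split.
  rewrite /scale sorted_map; apply: sub_sorted so => a b /=.
  by rewrite leq_pmul2l.
apply/mapP => -[x xl /esym/eqP]; rewrite muln_eq0 => /orP[/eqP e|/eqP e].
  by rewrite e in k0.
by rewrite -e xl in no0.
Qed.

Lemma sumn_scale k (la : seq nat) : sumn (scale k la) = (k * sumn la)%N.
Proof. by elim: la => [|a s IH] /=; rewrite ?muln0 // IH mulnDr. Qed.

(** The partition with parts t 0, t 1, ..., cut at the first zero before [n]. *)
Definition trim (n : nat) (t : nat -> nat) : seq nat :=
  mkseq t (find (fun j => t j == 0%N) (iota 0 n)).

Lemma trimP (n : nat) (t : nat -> nat) :
  (forall j, (j.+1 < n)%N -> (t j.+1 <= t j)%N) ->
  [/\ is_part (trim n t), (size (trim n t) <= n)%N &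
      forall j, (j < n)%N -> nth 0%N (trim n t) j = t j].
Proof.
move=> ni.
have anti i j : (i <= j < n)%N -> (t j <= t i)%N.
  case/andP; elim: j => [|j IH]; first by rewrite leqn0 => /eqP ->.
  rewrite leq_eqVlt => /orP[/eqP ->//|lt_ij lt_jn].
  by apply: leq_trans (ni _ lt_jn) _; apply: IH => //; apply: ltnW.
set k := find (fun j => t j == 0%N) (iota 0 n).
have le_kn : (k <= n)%N by rewrite -[n in (_ <= n)%N](size_iota 0); apply: find_size.
have pos j : (j < k)%N -> (0 < t j)%N.
  move=> lt; have := before_find 0%N lt.
  by rewrite nth_iota ?add0n ?lt0n => [->//|]; apply: leq_trans le_kn.
have zero j : (k <= j < n)%N -> t j = 0%N.
  move=> h; have lt_kn : (k < n)%N by case/andP: h; apply: leq_ltn_trans.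
  have hasz : has (fun j => t j == 0%N) (iota 0 n) by rewrite has_find size_iota.
  have := nth_find 0%N hasz; rewrite nth_iota // add0n => /eqP e0.
  by apply/eqP; rewrite -leqn0 -[X in (_ <= X)%N]e0; apply: anti.
rewrite /trim -/k; split; last 2 first.
- by rewrite size_mkseq.
- move=> j lt; case: (ltnP j k) => [lt_jk|le]; first by rewrite nth_mkseq.
  by rewrite nth_default ?size_mkseq // zero // le.
apply/andP; split.
  apply/(sortedP 0%N) => i; rewrite size_mkseq => lt.
  by rewrite !nth_mkseq ?(ltnW lt) //=; apply: anti; rewrite leqnSn (leq_trans lt).
apply/mapP => -[j]; rewrite mem_iota add0n => /= /pos lt e.
by rewrite -e in lt.
Qed.

Section Cells.
Variables (la : seq nat) (pla : is_part la).

Lemma cell_inj (c d : cell la) : crow c = crow d -> ccol c = ccol d -> c = d.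
Proof.
case: c => [[a b] h]; case: d => [[a' b'] h'].
rewrite /crow /ccol /= => e1 e2; apply: val_inj => /=.
by congr (_, _); apply: val_inj.
Qed.

Lemma cell_ex (i j : nat) : (j < nth 0 la i)%N ->
  exists2 c : cell la, crow c = i & ccol c = j.
Proof.
move=> lt.
have lt_i : (i < size la)%N by rewrite -(nth_part_gt0 _ pla); apply: leq_ltn_trans lt.
have lt_j : (j < head 0 la)%N.
  by rewrite -nth0; apply: leq_trans lt _; apply: nth_part_noninc.
by exists (exist _ (Ordinal lt_i, Ordinal lt_j) lt).
Qed.

Lemma ccol_lt (c : cell la) : (ccol c < nth 0 la (crow c))%N.
Proof. exact: (valP c). Qed.

Lemma card_cell : #|cell la| = sumn la.
Proof.
rewrite (sumn_nth (leqnn _)) -(@card_inside _ _ _ cell_inj _ (nth 0%N la) cell_ex).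
  by apply: eq_card => c; rewrite /in_mem /= /inside ccol_lt.
by move=> j; apply: nth_default.
Qed.

Section Semistandard.
Variable n : nat.

Lemma semistandardP (T : {ffun cell la -> 'I_n}) :
  reflect ((forall c d, crow c = crow d -> (ccol c < ccol d)%N -> (T c <= T d)%N) /\
           (forall c d, ccol c = ccol d -> (crow c < crow d)%N -> (T c < T d)%N))
          (semistandard T).
Proof.
apply: (iffP forallP) => [h|[h1 h2] c].
  split=> c d e lt; have /forallP/(_ d)/andP[/implyP a /implyP b] := h c.
    by apply: a; rewrite e eqxx.
  by apply: b; rewrite e eqxx.
apply/forallP => d; apply/andP; split; apply/implyP => /andP[/eqP e lt].
  exact: h1.
exact: h2.
Qed.

(** The weight of a filling: the number of occurrences of each letter. *)
Definition content (T : {ffun cell la -> 'I_n}) : 'X_{1..n} :=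
  [multinom #|[pred c | T c == i]| | i < n].

Lemma schur_content : schur n la = \sum_(T | semistandard T) 'X_[content T].
Proof.
apply: eq_bigr => T _; rewrite mprodXE; congr 'X_[_].
apply/mnmP => i; rewrite mnm_sumE mnmE -sum1_card [RHS]big_mkcond /=.
by apply: eq_bigr => c _; rewrite mnm1E inE; case: eqP.
Qed.

Lemma mcoeff_schur m :
  (schur n la)@_m = (#|[pred T | semistandard T & content T == m]|)%:R.
Proof.
rewrite schur_content raddf_sum /= -sum1_card natr_sum big_mkcondr /=.
by apply: eq_bigr => T _; rewrite mcoeffX; case: eqP.
Qed.

Lemma mcoeff_schur_neq0 m : (schur n la)@_m != 0 ->
  exists2 T : {ffun cell la -> 'I_n}, semistandard T & content T = m.
Proof.
rewrite mcoeff_schur pnatr_eq0 -lt0n => /card_gt0P[T].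
by rewrite inE => /andP[sT /eqP]; exists T.
Qed.

Lemma mdeg_content T : mdeg (content T) = sumn la.
Proof.
rewrite -card_cell mdegE -sum1_card.
rewrite (partition_big T xpredT) //=; apply: eq_bigr => i _.
by rewrite mnmE sum1_card; apply: eq_card.
Qed.

(** Cells with the same entry lie in different columns. *)
Lemma content_le T i : semistandard T -> (content T i <= head 0 la)%N.
Proof.
move=> /semistandardP[_ h]; rewrite mnmE -[X in (_ <= X)%N]card_ord.
apply: (@leq_card_in _ _ (fun c : cell la => (val c).2)).
  move=> c d; rewrite !inE => /eqP ec /eqP ed /(congr1 val) e.
  have e' : ccol c = ccol d by [].
  case: (ltngtP (crow c) (crow d)) => [lt|lt|eqr]; last exact: cell_inj.
    by have := h c d e' lt; rewrite ec ed ltnn.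
  by have := h d c (esym e') lt; rewrite ec ed ltnn.
Qed.

End Semistandard.

(** The i-th variable, or 0 when there is none. *)
Definition mvar (n i : nat) : {mpoly int[n]} := oapp (fun j : 'I_n => 'X_j) 0 (insub i).

Lemma mvarE n (i : 'I_n) : mvar n i = 'X_i.
Proof. by rewrite /mvar valK. Qed.

Lemma bounded_semistandard N (T : {ffun cell la -> 'I_N.+1}) :
  bounded_tableau (@crow la) (@ccol la) N.+1 (nth 0%N la) T = semistandard T.
Proof.
apply/(bounded_tableauP)/semistandardP => [[_ _ h3 h4]|[h3 h4]].
  by split=> c d; [apply: h3|apply: h4]; rewrite /inside ccol_lt.
split=> [c _|c|c d _ _|c d _ _]; first exact: ltn_ord.
- by rewrite /inside ccol_lt.
- exact: h3.
- exact: h4.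
Qed.

Lemma schur_alternant n : (size la <= n)%N ->
  schur n la * alternant (mvar n) n (fun j => n.-1 - j)%N =
  alternant (mvar n) n (fun j => nth 0 la j + (n.-1 - j))%N.
Proof.
case: n => [|N] le.
  rewrite /alternant !det_mx00 mulr1 /schur.
  have noc (c : cell la) : False 
    by have := leq_trans (ltn_ord (val c).1) le.
  have fe (T : {ffun cell la -> 'I_0}) : T = [ffun c => False_rect _ (noc c)].
    by apply/ffunP => c; case: (noc c).
  rewrite (big_pred1 [ffun c => False_rect _ (noc c)]).
    by rewrite big_pred0 // => c; case: (noc c).
  by move=> T; rewrite /= [X in X == _]fe eqxx; apply/forallP => c; case: (noc c).
rewrite -(@tableau_sum_alternant _ _ _ cell_inj _ (mvar N.+1) N N.+1 (nth 0%N la)) //.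
- congr (_ * _); rewrite /schur /tableau_sum.
  apply: eq_big => T; first by rewrite bounded_semistandard.
  move=> _; apply: eq_big => c; first by rewrite /inside ccol_lt.
  by rewrite mvarE.
- exact: cell_ex.
- by move=> j; apply: nth_part_noninc.
- by move=> j le_j; apply: nth_default; apply: leq_trans le_j.
Qed.

(** The entries of a column are distinct, so that its length is at most [n]. *)
Lemma schur_eq0 n : (n < size la)%N -> schur n la = 0.
Proof.
move=> lt; rewrite /schur big_pred0 // => T; apply/negP => sT.
have := lt; rewrite -(nth_part_gt0 _ pla) => /cell_ex[c rc _].
case: n lt T sT rc => [|N] lt T sT rc; first by case: (T c).
rewrite -bounded_semistandard in sT.
have ni j : (nth 0 la j.+1 <= nth 0 la j)%N by apply: nth_part_noninc.
have := tableau_ge_row cell_ex ni sT (ccol_lt c).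
by rewrite rc leqNgt ltn_ord.
Qed.

End Cells.

(** * Alternating polynomials and Schur expansions in n variables *)

Lemma perm_le_id n (s : 'S_n) : (forall i : 'I_n, (s i <= i)%N) -> s = 1%g.
Proof.
move=> le; apply/permP => i; rewrite perm1.
move e: (nat_of_ord i) => m; elim/ltn_ind: m i e => m IH i e.
apply/val_inj/eqP; have := le i; rewrite leq_eqVlt => /orP[//|lt].
have /perm_inj e' : s (s i) = s i by apply: (IH (s i)) => //; rewrite -e.
by rewrite e' ltnn in lt.
Qed.

Lemma perm_ge_id n (s : 'S_n) : (forall i : 'I_n, (i <= s i)%N) -> s = 1%g.
Proof.
move=> ge; rewrite -[s]invgK; apply/eqP; rewrite eq_invg1; apply/eqP.
by apply: perm_le_id => i; have := ge ((s^-1)%g i); rewrite permKV.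
Qed.

Lemma perm_incr_id n (s : 'S_n) :
  (forall i j : 'I_n, (i < j)%N -> (s i < s j)%N) -> s = 1%g.
Proof.
move=> inc; apply: perm_ge_id => i.
move e: (nat_of_ord i) => m; elim: m i e => [//|m IH] i e.
have lt_m : (m < n)%N by rewrite -e ltnW.
have le := IH (Ordinal lt_m) erefl.
by apply: leq_ltn_trans le _; apply: inc; rewrite e.
Qed.

Section Alternating.
Variable n : nat.
Implicit Types (m : 'X_{1..n}) (l : nat -> nat) (p : {mpoly int[n]}).

Notation alt := (alternant (mvar n) n).
Notation "m # s" := [multinom m (fun_of_perm s i) | i < n] (at level 40).

(** The exponents l 0, ..., l (n-1) as a monomial; [monom_nat] goes back, with
exponent 0 from n on. *)
Definition monom l : 'X_{1..n} := [multinom l i | i < n].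

Lemma alternantE l : alt l = \sum_(s : 'S_n) (-1) ^+ s *: 'X_[monom l # s].
Proof.
apply: eq_bigr => s _; rewrite mpolyXE_id.
rewrite mulr_sign scaler_sign.
case: (s : bool); [congr (- _)|]; apply: eq_bigr => i _.
  by rewrite !mxE mvarE !mnmE.
by rewrite !mxE mvarE !mnmE.
Qed.

Lemma mcoeffXM m p m' :
  ('X_[m] * p)@_m' = if [forall i : 'I_n, (m i <= m' i)%N] then p@_(m' - m) else 0.
Proof.
rewrite mulrC; case: ifPn => [/forallP le|nle].
  have {1}-> : m' = (m + (m' - m))%MM.
    by apply/mnmP => i; rewrite mnmDE mnmBE subnKC.
  exact: mcoeffMX.
rewrite {1}[p]mpolyE mulr_suml raddf_sum big1 //= => k _.
rewrite -scalerAl -mpolyXD mcoeffZ mcoeffX; case: eqP => [e|_]; last by rewrite mulr0.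
case/negP: nle; apply/forallP => i.
by rewrite -e mnmDE leq_addl.
Qed.

Lemma mcoeff_alternantM l p m : (alt l * p)@_m =
  \sum_(s : 'S_n) (-1) ^+ s *
    (if [forall i : 'I_n, (l (s i) <= m i)%N] then p@_(m - (monom l # s)) else 0).
Proof.
rewrite alternantE mulr_suml raddf_sum; apply: eq_bigr => s _ /=.
rewrite -scalerAl mcoeffZ mcoeffXM; congr (_ * _).
have -> // : [forall i : 'I_n, ((monom l # s) i <= m i)%N] =
             [forall i : 'I_n, (l (s i) <= m i)%N].
by apply: eq_forallb => i; rewrite !mnmE.
Qed.

Lemma mcoeff_alternantM_neq0 l p m : (alt l * p)@_m != 0 ->
  exists s : 'S_n, (forall i : 'I_n, (l (s i) <= m i)%N) /\
    p@_(m - (monom l # s)) != 0.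
Proof.
move=> nz; case: (pickP [pred s : 'S_n | [forall i : 'I_n, (l (s i) <= m i)%N]
  && (p@_(m - (monom l # s)) != 0)]) => [s /andP[/forallP h1 h2]|none].
  by exists s.
case/eqP: nz; rewrite mcoeff_alternantM big1 // => s _.
have := none s; rewrite /=; case: ifP => _ /=; last by rewrite mulr0.
by move/negbFE/eqP ->; rewrite mulr0.
Qed.

(** Strictly decreasing exponents: those of the form la + rho. *)
Definition sdecr m := [forall i : 'I_n, forall j : 'I_n, (i < j)%N ==> (m j < m i)%N].

Lemma sdecrP m : reflect (forall i j : 'I_n, (i < j)%N -> (m j < m i)%N) (sdecr m).
Proof.
apply: (iffP forallP) => [h i j|h i]; first by have /forallP/(_ j)/implyP := h i.
by apply/forallP => j; apply/implyP; apply: h.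
Qed.

(** An alternant with strictly decreasing exponents has exactly one monomial with
strictly decreasing exponents, its diagonal one. *)
Lemma mcoeff_alternant l m : sdecr (monom l) -> sdecr m ->
  (alt l)@_m = (monom l == m)%:R.
Proof.
move=> /sdecrP dl /sdecrP dm; rewrite alternantE raddf_sum (bigD1 1%g) //= big1.
  rewrite addr0 odd_perm1 scale1r mcoeffX; congr (_ == _)%:R.
  by apply/mnmP => i; rewrite !mnmE perm1.
move=> s ns; rewrite mcoeffZ mcoeffX; case: eqP => [e|_]; last by rewrite mulr0.
case/eqP: ns; apply: perm_incr_id => i j lt.
have := dm _ _ lt; rewrite -e !mnmE => lt'.
case: ltngtP => // [gt|eq].
  by have := dl _ _ gt; rewrite !mnmE ltnNge (ltnW lt').
by move: lt'; rewrite eq ltnn.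
Qed.

(** Permuting the variables multiplies [p] by the sign of the permutation. *)
Definition alternating p := forall s : 'S_n, msym s p = (-1) ^+ s *: p.

Lemma alternant_alternating l : alternating (alt l).
Proof.
move=> s; apply/mpolyP => m; rewrite mcoeff_sym mcoeffZ !alternantE !raddf_sum /=.
rewrite mulr_sumr (reindex_inj (mulgI s)) /=; apply: eq_bigr => t _.
rewrite !mcoeffZ odd_permM signr_addb !mcoeffX -mulrA; congr (_ * (_ * _%:R)).
congr (nat_of_bool _); apply/eqP/eqP => [e|<-].
  apply/mnmP => i; have /mnmP/(_ ((s^-1)%g i)) := e.
  by rewrite !mnmE permM permKV.
by apply/mnmP => i; rewrite !mnmE permM.
Qed.

Lemma alternating_mcoeff p (s : 'S_n) m : alternating p -> p@_(m # s) = (-1) ^+ s * p@_m.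
Proof. by move=> ap; rewrite -mcoeff_sym ap mcoeffZ. Qed.

(** Every monomial can be sorted; equal exponents are killed by a transposition. *)
Lemma alternating_eq0 p : alternating p -> (forall m, sdecr m -> p@_m = 0) -> p = 0.
Proof.
move=> ap h; apply/mpolyP => m; rewrite mcoeff0.
have /tuple_permP[s es] : perm_eq (sort geq (val m)) (val m).
  by rewrite perm_sort.
have srt (i j : 'I_n) : (i < j)%N -> ((m # s) j <= (m # s) i)%N.
  move=> lt.
  have so : sorted geq (sort geq (val m)) by apply: sort_sorted => a b; apply: leq_total.
  have := @sorted_leq_nth _ geq (fun a b c h1 h2 => leq_trans h2 h1) leqnn 0%N _ so i j.
  rewrite !inE size_sort size_tuple !ltn_ord ltnW // => /(_ isT isT isT).
  rewrite es !nth_mktuple.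
  by rewrite !mnmE !mnm_tnth.
have e0 : p@_(m # s) = 0.
  case: (boolP (sdecr (m # s))) => [/h //|].
  rewrite negb_forall => /existsP[i]; rewrite negb_forall => /existsP[j].
  rewrite negb_imply => /andP[lt]; rewrite -leqNgt => le.
  have eij : (m # s) i = (m # s) j by apply/eqP; rewrite eqn_leq le srt.
  have et : (m # s) # (tperm i j) = m # s.
    apply/mnmP => k; rewrite mnmE; case: tpermP => [->|->|//]; by rewrite ?eij.
  have := alternating_mcoeff (tperm i j) (m # s) ap; rewrite et odd_tperm neq_ltn lt /=.
  rewrite expr1 mulN1r => /eqP; rewrite -subr_eq0 opprK -mulr2n mulrn_eq0 /=.
  by move/eqP.
by move: e0; rewrite alternating_mcoeff // => /eqP; rewrite mulf_eq0 signr_eq0 => /eqP.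
Qed.

Lemma alternatingB p q : alternating p -> alternating q -> alternating (p - q).
Proof. by move=> ap aq s; rewrite /msym raddfB /= -!/(msym _ _) ap aq scalerBr. Qed.

Lemma alternating_sum (I : eqType) (r : seq I) (P : pred I) (F : I -> {mpoly int[n]}) :
  (forall i, alternating (F i)) -> alternating (\sum_(i <- r | P i) F i).
Proof.
move=> aF s; rewrite /msym raddf_sum scaler_sumr /=; apply: eq_bigr => i _; exact: aF.
Qed.

Lemma alternatingZ (c : int) p : alternating p -> alternating (c *: p).
Proof.
move=> ap s; apply/mpolyP => m; rewrite mcoeff_sym !mcoeffZ.
by have /mpolyP/(_ m) := ap s; rewrite mcoeff_sym mcoeffZ => ->; rewrite mulrCA.
Qed.

Definition monom_nat m (i : nat) : nat := oapp (fun j : 'I_n => m j) 0%N (insub i).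

Lemma monom_natE m (i : 'I_n) : monom_nat m i = m i.
Proof. by rewrite /monom_nat valK. Qed.

Lemma monom_natK m : monom (monom_nat m) = m.
Proof. by apply/mnmP => i; rewrite mnmE monom_natE. Qed.

Lemma alternating_expansion p : alternating p ->
  p = \sum_(m <- msupp p | sdecr m) p@_m *: alt (monom_nat m).
Proof.
move=> ap; apply/eqP; rewrite -subr_eq0; apply/eqP; apply: alternating_eq0.
  apply: alternatingB => //; apply: alternating_sum => m.
  by apply: alternatingZ; apply: alternant_alternating.
move=> m dm; rewrite mcoeffB raddf_sum /=.
rewrite (eq_bigr (fun m' => p@_m' * (m' == m)%:R)); last first.
  by move=> m' dm'; rewrite mcoeffZ mcoeff_alternant ?monom_natK.
apply/eqP; rewrite subr_eq0; apply/eqP.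
case: (boolP (m \in msupp p)) => [ms|ns].
  rewrite big_mkcond (bigD1_seq m) ?msupp_uniq //= dm eqxx mulr1 big1 ?addr0 //.
  by move=> m' /negPf ->; rewrite mulr0 if_same.
rewrite (memN_msupp_eq0 ns) big_seq_cond big1 // => m' /andP[m's _].
by case: eqP => [e|_]; [rewrite -e m's in ns | rewrite mulr0].
Qed.

(** The exponents la + rho. *)
Definition shifted (la : seq nat) (j : nat) : nat := (nth 0 la j + (n.-1 - j))%N.

Lemma sdecr_shifted la : is_part la -> sdecr (monom (shifted la)).
Proof.
move=> pl; apply/sdecrP => i j lt; rewrite !mnmE /shifted.
by have := nth_part_noninc pl (ltnW lt); have := ltn_ord j; lia.
Qed.

(** The partition la such that m = la + rho, for strictly decreasing [m]. *)
Definition part_of m : seq nat := trim n (fun j => monom_nat m j - (n.-1 - j))%N.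

Lemma part_ofP m : sdecr m ->
  [/\ is_part (part_of m), (size (part_of m) <= n)%N & monom (shifted (part_of m)) = m].
Proof.
move=> /sdecrP dm.
have dm' i j : (i < j < n)%N -> (monom_nat m j < monom_nat m i)%N.
  case/andP => lt ltn; have lti := ltn_trans lt ltn.
  have := dm (Ordinal lti) (Ordinal ltn) lt.
  by rewrite -!monom_natE.
have ge j : (j < n)%N -> (n.-1 - j <= monom_nat m j)%N.
  move=> lt; move e: (n.-1 - j)%N => d; elim: d j lt e => [//|d IH] j lt e.
  have lt1 : (j.+1 < n)%N by lia.
  have := IH _ lt1; have := dm' j j.+1; rewrite ltnS leqnn lt1 => /(_ isT) a b.
  by apply: leq_ltn_trans a; apply: b; lia.
have [|h1 h2 h3] := @trimP n (fun j => monom_nat m j - (n.-1 - j))%N.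
  move=> j lt; have := dm' j j.+1; rewrite ltnS leqnn lt => /(_ isT) a.
  by have := ge _ lt; have := ge _ (ltnW lt); lia.
split=> //; apply/mnmP => i; rewrite !mnmE /shifted h3 //.
by rewrite subnK ?ge // monom_natE.
Qed.

Lemma monom_shifted_inj la mu : is_part la -> is_part mu ->
  (size la <= n)%N -> (size mu <= n)%N ->
  monom (shifted la) = monom (shifted mu) -> la = mu.
Proof.
move=> pl pm sl sm /mnmP e; apply: part_eq => // i.
case: (ltnP i n) => [lt|ge]; last by rewrite !nth_default // (leq_trans _ ge).
by have := e (Ordinal lt); rewrite !mnmE /shifted => /addIn.
Qed.

(** V = a_rho. *)
Definition vandermonde : {mpoly int[n]} := alt (fun j => n.-1 - j)%N.

Lemma schur_vandermonde la : is_part la -> (size la <= n)%N ->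
  vandermonde * schur n la = alt (shifted la).
Proof. by move=> pl sl; rewrite mulrC schur_alternant. Qed.

Lemma vandermonde_neq0 : vandermonde != 0.
Proof.
have e : vandermonde = alt (shifted [::]).
  by congr (\det _); apply/matrixP => i j; rewrite !mxE /shifted nth_nil.
apply/eqP => v0.
have d : sdecr (monom (shifted [::])) by exact: sdecr_shifted.
have := mcoeff_alternant d d; rewrite -e v0 mcoeff0 eqxx => /eqP.
by rewrite eq_sym oner_eq0.
Qed.

Lemma schur_sym la : is_part la -> schur n la \is symmetric.
Proof.
move=> pl; case: (leqP (size la) n) => [le|lt]; last by rewrite (schur_eq0 pl lt) rpred0.
apply/issymP => s; apply: (mulfI vandermonde_neq0); rewrite schur_vandermonde //.
have := alternant_alternating (shifted la) s; rewrite -schur_vandermonde //.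
rewrite /msym rmorphM /= -!/(msym _ _).
have -> : msym s vandermonde = (-1) ^+ s *: vandermonde.
  exact: alternant_alternating.
rewrite -scalerAl => /(congr1 (fun q => (-1) ^+ s *: q)); rewrite !scalerA -signr_addb addbb !scale1r => ->.
by [].
Qed.

Lemma vandermonde_schurM_alternating al be : is_part al -> is_part be ->
  alternating (vandermonde * schur n al * schur n be).
Proof.
move=> pa pb s; rewrite /msym !rmorphM /= -!/(msym _ _).
have /issymP -> := schur_sym pa; have /issymP -> := schur_sym pb.
by rewrite (alternant_alternating _ s) !scalerAl.
Qed.

(** The coefficient of x^{nu+rho} in V s_al s_be; it is the coefficient of s_nu
in s_al s_be as soon as [nu] has at most [n] parts ([expands_coef]). *)
Definition lr_coef (al be nu : seq nat) : int :=
  (vandermonde * schur n al * schur n be)@_(monom (shifted nu)).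

Local Open Scope fset_scope.

(** [c] is a Schur expansion of s_al s_be in [n] variables. *)
Definition expands (al be : seq nat) (c : {fsfun seq nat -> int with 0}) :=
  schur n al * schur n be = \sum_(mu <- finsupp c) schur n mu *~ c mu.

Lemma expands_coef al be c nu : (forall mu, mu \in finsupp c -> is_part mu) ->
  expands al be c -> is_part nu -> (size nu <= n)%N -> c nu = lr_coef al be nu.
Proof.
move=> pc ec pn sn; rewrite /lr_coef -mulrA ec mulr_sumr raddf_sum /=.
rewrite (eq_big_seq (fun mu => if mu == nu then c nu else 0)).
  case: (finsuppP c nu) => [nin|kin].
    rewrite big_seq big1 // => mu mus; case: eqP => // e.
  by rewrite (bigD1_seq nu) ?fset_uniq //= eqxx big1 ?addr0 // => mu /negPf ->.
move=> mu mus; have pm := pc _ mus.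
rewrite mulrzAr raddfMz /=; case: (leqP (size mu) n) => [le|gt]; last first.
  rewrite (schur_eq0 pm gt) mulr0 mcoeff0 mul0rz; case: eqP => // e.
  by move: gt; rewrite e ltnNge sn.
rewrite schur_vandermonde // mcoeff_alternant; try exact: sdecr_shifted.
case: eqP => [/monom_shifted_inj e|ne].
  by rewrite e // eqxx intz.
by case: eqP => [e|_]; [rewrite e in ne | rewrite mul0rz].
Qed.

Lemma lr_coefE al be nu : is_part al -> (size al <= n)%N ->
  lr_coef al be nu = (alt (shifted al) * schur n be)@_(monom (shifted nu)).
Proof. by move=> pa sa; rewrite /lr_coef schur_vandermonde. Qed.

Lemma lr_coef_support al be m : is_part al -> is_part be ->
  (vandermonde * schur n al * schur n be)@_m != 0 ->
  (mdeg m = mdeg (monom (shifted al)) + sumn be)%N.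
Proof.
move=> pa pb nz.
have sa : (size al <= n)%N.
  by rewrite leqNgt; apply/negP => gt; rewrite (schur_eq0 pa gt) mulr0 mul0r mcoeff0 eqxx in nz.
rewrite schur_vandermonde // in nz.
have [s [le]] := mcoeff_alternantM_neq0 nz.
case/mcoeff_schur_neq0 => T _ eT.
rewrite -(mdeg_content pb T) eT.
rewrite -(mdeg_mperm (monom (shifted al)) s) -mdegD; congr mdeg.
by apply/mnmP => i; rewrite mnmDE mnmBE subnKC // !mnmE.
Qed.

Lemma mdeg_shifted la : (size la <= n)%N ->
  mdeg (monom (shifted la)) = (sumn la + \sum_(j < n) (n.-1 - j))%N.
Proof.
move=> le; rewrite mdegE (sumn_nth le) -big_split; apply: eq_bigr => i _.
by rewrite mnmE.
Qed.

Lemma expansion_exists al be : is_part al -> is_part be ->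
  exists c : {fsfun seq nat -> int with 0},
  [/\ expands al be c, forall nu, nu \in finsupp c -> is_part nu &
      forall nu, nu \in finsupp c -> sumn nu = (sumn al + sumn be)%N].
Proof.
move=> pa pb; set p := vandermonde * schur n al * schur n be.
(* c nu is the coefficient of x^{nu+rho}, for the strictly decreasing monomials. *)
pose ms := [seq m <- msupp p | sdecr m].
pose L := [seq part_of m | m <- ms].
have uL : uniq L.
  rewrite map_inj_in_uniq ?filter_uniq ?msupp_uniq // => m m'.
  rewrite !mem_filter => /andP[d _] /andP[d' _] e.
  by have [_ _ <-] := part_ofP d; have [_ _ <-] := part_ofP d'; rewrite e.
pose c : {fsfun seq nat -> int with 0} :=
  [fsfun nu in [fset nu in L] => lr_coef al be nu | 0].
have cE nu : c nu = if nu \in L then lr_coef al be nu else 0.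
  by rewrite fsfunE in_fset.
have inL nu : nu \in finsupp c ->
    exists m, [/\ sdecr m, m \in msupp p & nu = part_of m].
  rewrite mem_finsupp cE; case: ifP => [/mapP[m]|]; last by rewrite eqxx.
  by rewrite mem_filter => /andP[d ms'] -> _; exists m.
exists c; split.
- rewrite /expands; apply: (mulfI vandermonde_neq0); rewrite mulrA -/p.
  have ap : alternating p by apply: vandermonde_schurM_alternating.
  rewrite [LHS](alternating_expansion ap).
  rewrite mulr_sumr.
  transitivity (\sum_(nu <- L) vandermonde * (schur n nu *~ c nu)).
    rewrite [RHS]big_map -[LHS]big_filter -/ms; apply: eq_big_seq => m mm.
    have /andP[d _] : sdecr m && (m \in msupp p) by rewrite -mem_filter.
    have [pm sm em] := part_ofP d.
    rewrite cE map_f // /lr_coef em -/p mulrzAr schur_vandermonde // -scaler_int.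
    congr (_ *: _); first by rewrite intz.
    congr (\det _); apply/matrixP => i j; rewrite !mxE monom_natE.
    by have /mnmP/(_ j) := em; rewrite mnmE => ->.
  transitivity (\sum_(nu <- L | nu \in finsupp c) vandermonde * (schur n nu *~ c nu)).
    rewrite [RHS]big_mkcond; apply: eq_bigr => nu _; case: ifPn => // nin.
    by rewrite fsfun_dflt // mulr0z mulr0.
  rewrite -big_filter; apply: perm_big; apply: uniq_perm; rewrite ?filter_uniq ?fset_uniq //.
  move=> nu; rewrite mem_filter; case: (boolP (nu \in finsupp c)) => //=.
  by rewrite mem_finsupp cE; case: ifP => //; rewrite eqxx.
- by move=> nu /inL[m [d _ ->]]; have [] := part_ofP d.
- move=> nu /inL[m [d ms' ->]]; have [pm sm em] := part_ofP d.
  have nz : p@_m != 0 by rewrite -mcoeff_msupp.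
  have sa : (size al <= n)%N.
    rewrite leqNgt; apply/negP => gt.
    by rewrite /p (schur_eq0 pa gt) mulr0 mul0r mcoeff0 eqxx in nz.
  have := lr_coef_support pa pb nz; rewrite -{1}em !mdeg_shifted //.
  by rewrite addnAC => /addIn.
Qed.

End Alternating.

(** * Littlewood-Richardson coefficients: existence and bounds *)

Section Restriction.
Variables (m n : nat) (le_mn : (m <= n)%N).

(** Setting the variables from the m-th on to zero. *)
Definition restr : {mpoly int[n]} -> {mpoly int[m]} :=
  mmap (@mpolyC m int) (fun i : 'I_n => mvar m i).

Lemma restr_schur la : restr (schur n la) = schur m la.
Proof.
rewrite /restr /schur rmorph_sum /=.
rewrite (eq_bigr (fun T : {ffun cell la -> 'I_n} => \prod_(c : cell la) mvar m (T c))); last first.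
  by move=> T _; rewrite rmorph_prod /=; apply: eq_bigr => c _; rewrite mmapX mmap1U.
pose w (T : {ffun cell la -> 'I_m}) : {ffun cell la -> 'I_n} :=
  [ffun c => widen_ord le_mn (T c)].
have w_inj : injective w.
  move=> T T' /ffunP e; apply/ffunP => c; have := e c; rewrite !ffunE => /(congr1 val) /= e'.
  exact: val_inj.
have semi_w T : semistandard (w T) = semistandard T.
  by apply: eq_forallb => c; apply: eq_forallb => d; rewrite !ffunE.
rewrite (bigID (fun T : {ffun cell la -> 'I_n} => [forall c, (T c < m)%N])) /=.
rewrite [X in _ + X]big1 ?addr0; last first.
  move=> T /andP[_]; rewrite negb_forall => /existsP[c]; rewrite -leqNgt => ge.
  by rewrite (bigD1 c) //= /mvar insubF ?mul0r // ltnNge ge.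
transitivity (\sum_(T in w @: [set T | semistandard T]) \prod_(c : cell la) mvar m (T c)).
  apply: eq_bigl => T; apply/andP/imsetP => [[sT /forallP lt]|[T' sT' ->]].
    have e : T = w [ffun c => Ordinal (lt c)].
      by apply/ffunP => c; rewrite !ffunE; apply: val_inj.
    by exists [ffun c => Ordinal (lt c)] => //; rewrite inE -semi_w -e.
  rewrite inE in sT'; rewrite semi_w sT'; split=> //.
  by apply/forallP => c; rewrite ffunE /=.
rewrite big_imset /=; last by move=> T T' _ _; apply: w_inj.
apply: eq_big => T; first by rewrite inE.
by move=> _; apply: eq_bigr => c _; rewrite ffunE /= mvarE.
Qed.

Lemma restr_expands al be c : expands n al be c -> expands m al be c.
Proof.
have restrM p q : restr (p * q) = restr p * restr q by rewrite /restr rmorphM.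
rewrite /expands => /(congr1 restr); rewrite restrM !restr_schur => ->.
rewrite [LHS](rmorph_sum (mmap (@mpolyC m int) (fun i : 'I_n => mvar m i))) /=.
apply: eq_bigr => mu _; rewrite -/(restr _).
rewrite /restr rmorphMz; congr (_ *~ _); exact: restr_schur.
Qed.

End Restriction.

(** An expansion in N = |al| + |be| variables is valid in any number of variables:
for fewer variables by restriction; for more, because the expansion there only
involves partitions of N, so that it has the same coefficients. *)
Lemma schur_expansion_ex al be : is_part al -> is_part be ->
  exists c, schur_expansion al be c.
Proof.
move=> pa pb; pose N := (sumn al + sumn be)%N.
have [c [ec pc sc]] := expansion_exists N pa pb.
exists c; split=> // n; case: (leqP n N) => [le|gt].
  exact: (restr_expands le ec).
have [c' [ec' pc' sc']] := expansion_exists n pa pb.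
suff -> : c = c' by [].
have eN := restr_expands (ltnW gt) ec'.
apply/fsfunP => nu.
case: (boolP (is_part nu && (size nu <= N)%N)) => [/andP[pn sn]|npn].
  by rewrite (expands_coef pc ec) // (expands_coef pc' eN).
have out (d : {fsfun seq nat -> int with 0}) :
    (forall mu, mu \in finsupp d -> is_part mu) ->
    (forall mu, mu \in finsupp d -> sumn mu = N) -> d nu = 0.
  move=> pd sd; apply: fsfun_dflt; apply: contra npn => nus.
  by rewrite pd // -(sd _ nus) size_part_le // pd.
by rewrite !out.
Qed.

Lemma LR_coef n al be nu : is_part al -> is_part be -> is_part nu ->
  (size nu <= n)%N -> LR al be nu = lr_coef n al be nu.
Proof.
move=> pa pb pn sn.
have [pc ec] := classical_sets.xgetPex [fsfun] (schur_expansion_ex pa pb).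
exact: (expands_coef pc (ec n)).
Qed.

Lemma LR_sym al be nu : is_part al -> is_part be -> is_part nu ->
  LR al be nu = LR be al nu.
Proof.
move=> pa pb pn; rewrite !(@LR_coef (size nu)) //.
by rewrite /lr_coef mulrAC.
Qed.

Lemma LR_sumn al be nu : is_part al -> is_part be -> is_part nu ->
  LR al be nu != 0 -> sumn nu = (sumn al + sumn be)%N.
Proof.
move=> pa pb pn; pose n := (size nu + size al)%N.
have sn : (size nu <= n)%N by apply: leq_addr.
have sa : (size al <= n)%N by apply: leq_addl.
rewrite (LR_coef pa pb pn sn) => /(lr_coef_support pa pb).
by rewrite !mdeg_shifted // addnAC => /addIn.
Qed.

Lemma perm_pigeonhole n (s : 'S_n) (i : 'I_n) :
  exists2 j : 'I_n, (i <= j)%N & (s j <= i)%N.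
Proof.
case: (pickP [pred j : 'I_n | (i <= j)%N && (s j <= i)%N]) => [j /andP[]|none].
  by exists j.
pose S := [set j : 'I_n | (i <= j)%N].
have sub : s @: S \subset S :\ i.
  apply/subsetP => _ /imsetP[j jS ->]; rewrite inE in jS.
  have := none j; rewrite /= jS /= => /negbT; rewrite -ltnNge => lt.
  by rewrite !inE ltnW // andbT -val_eqE /= gtn_eqF.
have := subset_leq_card sub; rewrite card_imset; last exact: perm_inj.
by rewrite (cardsD1 i S) inE leqnn ltnn.
Qed.

Lemma shifted_anti n al (i j : 'I_n) : is_part al -> (i <= j)%N ->
  (shifted n al j <= shifted n al i)%N.
Proof.
move=> pa; rewrite leq_eqVlt => /orP[/eqP/val_inj ->//|lt].
by have /sdecrP/(_ _ _ lt) := sdecr_shifted n pa; rewrite !mnmE => /ltnW.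
Qed.

(** Adding to al + rho a permuted vector with entries in [0, be_1] moves its i-th
largest entry up by at most be_1. *)
Lemma LR_bounds al be nu : is_part al -> is_part be -> is_part nu ->
  LR al be nu != 0 ->
  forall i, (nth 0 al i <= nth 0 nu i <= nth 0 al i + head 0 be)%N.
Proof.
move=> pa pb pn; pose n := (size nu + size al)%N.
have sn : (size nu <= n)%N by apply: leq_addr.
have sa : (size al <= n)%N by apply: leq_addl.
rewrite (LR_coef pa pb pn sn) lr_coefE // => /mcoeff_alternantM_neq0[s [le]].
case/mcoeff_schur_neq0 => T sT eT k.
case: (ltnP k n) => [lt_k|ge]; last first.
  by rewrite !nth_default // (leq_trans _ ge).
pose i := Ordinal lt_k; rewrite -[k]/(nat_of_ord i).
have up (j : 'I_n) : (shifted n nu j <= shifted n al (s j) + head 0 be)%N.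
  have := content_le j sT; rewrite eT mnmBE !mnmE => h.
  by rewrite -leq_subLR.
apply/andP; split.
  have [j le_ij le_sj] := perm_pigeonhole s i.
  have h1 := shifted_anti pa le_sj; have h2 := shifted_anti pn le_ij.
  have := le j; rewrite mnmE => h3.
  by have := leq_trans h1 (leq_trans h3 h2); rewrite /shifted leq_add2r.
have [j' le_ij le_sj] := perm_pigeonhole (s^-1)%g i.
set j := (s^-1)%g j' in le_sj; have ej : s j = j' by rewrite /j permKV.
rewrite -ej in le_ij.
have h1 := shifted_anti pa le_ij; have h2 := shifted_anti pn le_sj.
have := leq_trans h2 (up j); rewrite -(leq_add2r (n.-1 - i)) => h.
move: h h1; rewrite /shifted; lia.
Qed.

Section Row.
Variables (n b : nat).

(** The cell in column [j] of a one-row shape. *)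
Definition row_cell (j : 'I_b) : cell [:: b] :=
  exist (fun c : 'I_1 * 'I_b => (c.2 < nth 0 [:: b] c.1)%N) (ord0, j) (ltn_ord j).

Lemma row_cellK (c : cell [:: b]) : row_cell (val c).2 = c.
Proof.
apply: val_inj; case: c => [[a j] h] /=; congr (_, _).
by apply: val_inj; case: a h => -[].
Qed.

(** The entries of a one-row tableau, read from left to right. *)
Definition row_word (T : {ffun cell [:: b] -> 'I_n}) : seq 'I_n :=
  [seq T (row_cell j) | j <- enum 'I_b].

Lemma nth_row_word x0 T (j : 'I_b) : nth x0 (row_word T) j = T (row_cell j).
Proof. by rewrite /row_word (nth_map j) ?size_enum_ord // nth_ord_enum. Qed.

Lemma size_row_word T : size (row_word T) = b.
Proof. by rewrite size_map size_enum_ord. Qed.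

Lemma count_row_word T i : count_mem i (row_word T) = content T i.
Proof.
rewrite mnmE /row_word count_map -size_filter.
transitivity (size [seq row_cell j | j <- enum 'I_b & T (row_cell j) == i]).
  by rewrite size_map; congr size; apply: eq_filter.
rewrite cardE; apply: perm_size; apply: uniq_perm; rewrite ?enum_uniq //.
  rewrite map_inj_uniq; first by apply: filter_uniq; apply: enum_uniq.
  by move=> j j' /(congr1 (fun c => (val c).2)).
move=> c; rewrite mem_enum inE; apply/mapP/idP => [[j]|Tc].
  by rewrite mem_filter => /andP[Tj _] ->.
exists (val c).2; last by rewrite row_cellK.
by rewrite mem_filter row_cellK mem_enum andbT.
Qed.

Lemma semistandard_row T :
  semistandard T = sorted (fun i j : 'I_n => (i <= j)%N) (row_word T).
Proof.
apply/semistandardP/idP => [[h _]|so].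
  rewrite /row_word sorted_map.
  have : sorted ltn (map val (enum 'I_b)) by rewrite val_enum_ord iota_ltn_sorted.
  by rewrite sorted_map; apply: sub_sorted => j j' lt; apply: h.
have row0 (c : cell [:: b]) : crow c = 0%N by rewrite /crow; case: (val c).1 => -[].
split=> c d; last by rewrite !row0.
move=> _ lt; rewrite -[c]row_cellK -[d]row_cellK.
move: lt; rewrite /ccol; move: (val c).2 (val d).2 => j j' lt.
have := @sorted_leq_nth _ (fun i j : 'I_n => (i <= j)%N)
  (fun x y z => @leq_trans x y z) (fun x => leqnn x) (T (row_cell j)) _ so j j'.
rewrite !inE size_row_word !ltn_ord ltnW // => /(_ isT isT isT).
by rewrite !nth_row_word.
Qed.

(** The complete homogeneous polynomial: a weakly increasing word is determined by
its content, which is arbitrary. *)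
Lemma mcoeff_schur_row m : is_part [:: b] -> (schur n [:: b])@_m = (mdeg m == b)%:R.
Proof.
move=> pb.
rewrite mcoeff_schur; congr _%:R.
case: eqP => [em|nm]; last first.
  apply: eq_card0 => T; rewrite !inE; apply/negP => /andP[_ /eqP e].
  by case: nm; rewrite -e (mdeg_content pb) /= addn0.
pose L := sort (fun i j : 'I_n => (i <= j)%N)
  (flatten [seq nseq (m i) i | i <- enum 'I_n]).
have so : sorted (fun i j : 'I_n => (i <= j)%N) L.
  by apply: sort_sorted => i j; apply: leq_total.
have cL i : count_mem i L = m i.
  rewrite count_sort count_flatten -map_comp sumnE big_map big_enum /= (bigD1 i) //=.
  rewrite count_nseq /= eqxx mul1n big1 ?addn0 // => j /negPf ne.
  by rewrite count_nseq /= ne.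
have sL : size L = b.
  rewrite size_sort size_flatten /shape -map_comp sumnE big_map big_enum /= -em mdegE.
  by apply: eq_bigr => i _; rewrite /= size_nseq.
pose T0 : {ffun cell [:: b] -> 'I_n} :=
  [ffun c => tnth (Tuple (introT eqP sL)) (val c).2].
have w0 : row_word T0 = L.
  rewrite /row_word -[RHS](map_tnth_enum (Tuple (introT eqP sL))).
  by apply: eq_map => j; rewrite ffunE.
rewrite (@eq_card1 _ T0) // => T; rewrite !inE.
apply/andP/eqP => [[sT /eqP cT]|->]; last first.
  rewrite semistandard_row w0; split=> //; apply/eqP/mnmP => i.
  by rewrite -count_row_word w0 cL.
have ew : row_word T = row_word T0.
  rewrite w0; apply: (@sorted_eq _ (fun i j : 'I_n => (i <= j)%N)) => //.
  - by move=> x y z; apply: leq_trans.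
  - by move=> x y /anti_leq e; apply: val_inj.
  - by rewrite -semistandard_row.
  by apply/allP => i _; apply/eqP; rewrite cL /= count_row_word cT.
apply/ffunP => c; rewrite -[c]row_cellK.
have /eq_in_map e := ew; apply: e; exact: mem_enum.
Qed.

End Row.

(** * Rows and rectangles: vanishing and positivity *)

Lemma schur_nil n : schur n [::] = 1.
Proof.
apply: (mulfI (vandermonde_neq0 n)); rewrite schur_vandermonde // mulr1.
by congr (\det _); apply/matrixP => i j; rewrite !mxE /shifted nth_nil.
Qed.

Lemma mcoeff_schur_size_le1 n be m : is_part be -> (size be <= 1)%N ->
  (schur n be)@_m = (mdeg m == sumn be)%:R.
Proof.
case: be => [|b [|//]] pb _; first by rewrite schur_nil mcoeff1 mdeg_eq0.
by rewrite mcoeff_schur_row //= addn0.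
Qed.

Lemma mdeg_monomB n (m m' : 'X_{1..n}) : (forall i, (m' i <= m i)%N) ->
  mdeg (m - m') = (mdeg m - mdeg m')%N.
Proof.
move=> le; have {2}-> : m = ((m - m') + m')%MM.
  by apply/mnmP => i; rewrite mnmDE mnmBE subnK.
by rewrite mdegD addnK.
Qed.

(** The vanishing half of the Pieri rule. *)
Lemma LR_row_strip al be nu : is_part al -> is_part be -> is_part nu ->
  (size be <= 1)%N -> LR al be nu != 0 ->
  forall i, (nth 0 nu i.+1 <= nth 0 al i)%N.
Proof.
move=> pa pb pn sb nz; have sumE := LR_sumn pa pb pn nz; move: nz.
pose n := (size nu + size al)%N.
have sn : (size nu <= n)%N by apply: leq_addr.
have sa : (size al <= n)%N by apply: leq_addl.
rewrite (LR_coef pa pb pn sn) lr_coefE // mcoeff_alternantM.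
pose M : 'M[int]_n := \matrix_(i, j) (shifted n al j <= shifted n nu i)%N%:R.
have -> : \sum_(s : 'S_n) (-1) ^+ s *
    (if [forall i : 'I_n, (shifted n al (s i) <= monom n (shifted n nu) i)%N]
     then (schur n be)@_(monom n (shifted n nu) - [multinom monom n (shifted n al) (s i) | i < n])
     else 0) = \det M.
  apply: eq_bigr => s _; congr (_ * _); case: ifPn => [/forallP le|].
    rewrite mcoeff_schur_size_le1 // mdeg_monomB => [|i]; last by rewrite !mnmE; have := le i; rewrite mnmE.
    rewrite mdeg_mperm !mdeg_shifted // sumE.
    rewrite [RHS]big1 => [|i _]; last by rewrite mxE; have := le i; rewrite mnmE => ->.
    by rewrite subnDr addKn eqxx.
  rewrite negb_forall => /existsP[i]; rewrite mnmE => /negPf nle.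
  by rewrite (bigD1 i) //= mxE nle mul0r.
move=> detM.
(* Two columns of M are distinct only if some row separates them. *)
have sep (i j : 'I_n) : (i < j)%N ->
    exists r : 'I_n, (shifted n al j <= shifted n nu r < shifted n al i)%N.
  move=> lt; case: (pickP [pred r : 'I_n |
    (shifted n al j <= shifted n nu r < shifted n al i)%N]) => [r hr|none].
    by exists r.
  case/eqP: detM; rewrite -det_tr.
  apply: (@determinant_alternate _ _ _ i j); first by rewrite neq_ltn lt.
  move=> r; rewrite !mxE; congr (_ _)%:R; have := none r; rewrite /=.
  have := shifted_anti pa (ltnW lt); lia.
(* By descending induction: the row r separating columns i and i+1 is at most
   i+1, because nu_{i+2} + rho_{i+2} < al_{i+1} + rho_{i+1}. *)
have strict i : (i.+1 < n)%N -> (shifted n nu i.+1 < shifted n al i)%N.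
  move=> lt; move e: (n - i)%N => d; elim: d i lt e => [|d IH] i lt e; first by lia.
  have [r /andP[h1 h2]] := sep (Ordinal (ltnW lt)) (Ordinal lt) (ltnSn i).
  have le_r : (r <= i.+1)%N.
    case: (ltnP i.+2 n) => [lt2|ge]; last by have := ltn_ord r; lia.
    have h3 : (shifted n nu i.+2 < shifted n al i.+1)%N by apply: IH => //; lia.
    rewrite leqNgt; apply/negP => lt_r.
    have := @shifted_anti n nu (Ordinal lt2) r pn lt_r.
    by move: h1 h3 => /=; lia.
  have := @shifted_anti n nu r (Ordinal lt) pn le_r.
  by move: h2 => /=; lia.
move=> i; case: (ltnP i.+1 n) => [lt|ge].
  by have := strict i lt; rewrite /shifted; lia.
by rewrite nth_default // (leq_trans sn).
Qed.

(** The exponent nu - al, i.e. the contribution of the identity permutation. *)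
Definition skew_weight n (al nu : seq nat) : 'X_{1..n} :=
  [multinom (nth 0 nu i - nth 0 al i)%N | i < n].

(** When the identity is the only permutation that can contribute, the coefficient
counts the tableaux of shape [be] and weight nu - al. *)
Lemma LR_pos n al be nu : is_part al -> is_part be -> is_part nu ->
  (size al <= n)%N -> (size nu <= n)%N ->
  (forall i, (nth 0 al i <= nth 0 nu i)%N) ->
  (schur n be)@_(skew_weight n al nu) != 0 ->
  (forall s : 'S_n, (forall i : 'I_n, (shifted n al (s i) <= shifted n nu i)%N) ->
     (forall i : 'I_n, (shifted n nu i <= shifted n al (s i) + head 0 be)%N) -> s = 1%g) ->
  0 < LR al be nu.
Proof.
move=> pa pb pn sa sn le_an nz uniq_s.
rewrite (LR_coef pa pb pn sn) lr_coefE // mcoeff_alternantM (bigD1 1%g) //= big1.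
  rewrite addr0 odd_perm1 mul1r ifT; last first.
    by apply/forallP => i; rewrite perm1 mnmE /shifted leq_add2r.
  rewrite lt_def mcoeff_schur ler0n andbT -mcoeff_schur.
  suff -> : (monom n (shifted n nu) - [multinom monom n (shifted n al) ((1%g : 'S_n) i) | i < n])%MM
            = skew_weight n al nu by [].
  by apply/mnmP => i; rewrite mnmBE !mnmE perm1 /shifted subnDr.
move=> s ns; case: ifPn => [/forallP le|_]; last by rewrite mulr0.
apply/eqP; rewrite mulf_eq0 signr_eq0 /=; apply/negPn/negP.
case/mcoeff_schur_neq0 => T sT eT; case/eqP: ns; apply: uniq_s => i.
  by have := le i; rewrite mnmE.
have := content_le i sT; rewrite eT mnmBE !mnmE => h.
by rewrite -leq_subLR.
Qed.

Lemma shifted_le n al (i j : 'I_n) : is_part al ->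
  (shifted n al i <= shifted n al j)%N = (j <= i)%N.
Proof.
move=> pa; apply/idP/idP => [le|]; last exact: shifted_anti.
rewrite leqNgt; apply/negP => lt.
have /sdecrP/(_ _ _ lt) := sdecr_shifted n pa; rewrite !mnmE.
by rewrite ltnNge le.
Qed.

(** The positive half of the Pieri rule: for a horizontal strip, a contributing
permutation satisfies i <= s i. *)
Lemma LR_row_pos al be nu : is_part al -> is_part be -> is_part nu ->
  (size be <= 1)%N -> sumn nu = (sumn al + sumn be)%N ->
  (forall i, (nth 0 al i <= nth 0 nu i)%N) ->
  (forall i, (nth 0 nu i.+1 <= nth 0 al i)%N) ->
  0 < LR al be nu.
Proof.
move=> pa pb pn sb es le1 le2; pose n := (size nu + size al)%N.
have sn : (size nu <= n)%N by apply: leq_addr.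
have sa : (size al <= n)%N by apply: leq_addl.
apply: (@LR_pos n) => //.
  rewrite mcoeff_schur_size_le1 //.
  suff -> : mdeg (skew_weight n al nu) = sumn be by rewrite eqxx.
  apply: (@addnI (sumn al)); rewrite -es (sumn_nth sa) (sumn_nth sn) mdegE -big_split /=.
  by apply: eq_bigr => i _; rewrite mnmE subnKC.
move=> s h _; apply: perm_ge_id => i.
rewrite leqNgt; apply/negP => lt.
have i0 : (0 < i)%N by apply: leq_ltn_trans lt.
have lt' : (i.-1 < n)%N by apply: leq_ltn_trans (leq_pred i) _.
have := @shifted_anti n al (s i) (Ordinal lt') pa.
have := h i; have := le2 i.-1; rewrite prednK // /shifted /=.
have := ltn_ord i; lia.
Qed.

Lemma is_part_nseq b k : (0 < k)%N -> is_part (nseq b k).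
Proof.
move=> k0; apply/andP; split.
  by apply/(sortedP 0%N) => i; rewrite size_nseq => lt; rewrite !nth_nseq lt (ltnW lt) /=.
by apply/negP => /nseqP[e _]; rewrite -e in k0.
Qed.

(** The tableau has all entries of its r-th row equal to the r-th element of [S]. *)
Lemma mcoeff_schur_rect n b k (S : {set 'I_n}) : (0 < k)%N -> #|S| = b ->
  (schur n (nseq b k))@_[multinom (if i \in S then k else 0)%N | i < n] != 0.
Proof.
move=> k0 cS; have pr := is_part_nseq b k0.
rewrite mcoeff_schur pnatr_eq0 -lt0n; apply/card_gt0P.
have row_lt (c : cell (nseq b k)) : (crow c < #|S|)%N.
  by rewrite cS -[X in (_ < X)%N](size_nseq b k); apply: ltn_ord.
pose T : {ffun cell (nseq b k) -> 'I_n} := [ffun c => enum_val (Ordinal (row_lt c))].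
have T_incr c d : (crow c < crow d)%N -> (T c < T d)%N.
  move=> lt; rewrite !ffunE.
  have so : sorted (fun i j : 'I_n => (i < j)%N) (enum S).
    rewrite /enum_mem; apply: sorted_filter => [x y z|]; first exact: ltn_trans.
    have : sorted ltn (map val (enum 'I_n)) by rewrite val_enum_ord iota_ltn_sorted.
    by rewrite sorted_map enumT.
  rewrite !(enum_val_nth (T c)).
  apply: (@sorted_ltn_nth _ (fun i j : 'I_n => (i < j)%N)) => //.
  - by move=> x y z; apply: ltn_trans.
  - by rewrite inE -cardE.
  - by rewrite inE -cardE.
exists T; rewrite inE; apply/andP; split.
  apply/semistandardP; split=> c d e lt; last exact: T_incr.
  by rewrite !ffunE leq_eqVlt; apply/orP; left; apply/eqP; congr (val (enum_val _)); apply: val_inj.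
apply/eqP/mnmP => i; rewrite !mnmE; case: ifPn => iS; last first.
  apply: eq_card0 => c; rewrite !inE ffunE; apply/eqP => e.
  by rewrite -e enum_valP in iS.
pose r := enum_rank_in iS i.
have er c : (T c == i) = (crow c == r).
  rewrite ffunE; apply/eqP/eqP => [e|e].
    by have := enum_valK_in iS (Ordinal (row_lt c)); rewrite e -/r => ->.
  have -> : Ordinal (row_lt c) = r by apply: val_inj.
  by rewrite enum_rankK_in.
have lt_r : (r < b)%N by rewrite -cS; apply: ltn_ord.
have nthE j : nth 0%N (nseq b k) j = if (j < b)%N then k else 0%N by rewrite nth_nseq.
have full : full_shape (@crow (nseq b k)) (@ccol _) (fun j => if j == r then k else 0)%N.
  move=> j l; case: eqP => // -> lt; apply: cell_ex => //.
  by rewrite nthE lt_r.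
have out j : (b <= j)%N -> (if j == r then k else 0)%N = 0%N.
  by move=> le; rewrite gtn_eqF // (leq_trans lt_r).
have := card_inside (@cell_inj _) full out.
rewrite (bigD1 (Ordinal lt_r)) //= eqxx big1 ?addn0 => [eqk|j]; last first.
  by rewrite -val_eqE /= => /negPf ->.
apply: etrans eqk; apply: eq_card => c; rewrite !inE er /in_mem /= /inside.
case: eqP => [e|_]; last by rewrite ltn0.
by have := ccol_lt c; rewrite e nthE lt_r.
Qed.

(** Let S be the set of rows where nu_i = al_i + k.  A contributing permutation
satisfies s i <= i on S and i <= s i off S; it maps S to itself because nu + rho
is strictly decreasing.  Hence it is the identity on S, and then everywhere. *)
Lemma LR_rect_pos al b k nu : is_part al -> is_part nu -> (0 < k)%N ->
  sumn nu = (sumn al + b * k)%N ->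
  (forall i, nth 0 nu i = nth 0 al i \/ nth 0 nu i = nth 0 al i + k)%N ->
  0 < LR al (nseq b k) nu.
Proof.
move=> pa pn k0 es dich; have pb := is_part_nseq b k0.
pose n := (size nu + size al)%N.
have sn : (size nu <= n)%N by apply: leq_addr.
have sa : (size al <= n)%N by apply: leq_addl.
have le i : (nth 0 al i <= nth 0 nu i)%N by case: (dich i) => ->; rewrite ?leq_addr.
pose S := [set i : 'I_n | nth 0%N nu i != nth 0%N al i].
have inS (i : 'I_n) : (nth 0 nu i = nth 0 al i + (if i \in S then k else 0))%N.
  rewrite inE; case: eqP => [->|ne] /=; first by rewrite addn0.
  by case: (dich i).
have cS : #|S| = b.
  move: es; rewrite (sumn_nth sn) (sumn_nth sa) (eq_bigr _ (fun i _ => inS i)) big_split /=.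
  move/addnI; rewrite -big_mkcond /= sum_nat_const => /eqP.
  by rewrite eqn_pmul2r // => /eqP.
apply: (@LR_pos n) => //.
  have -> : skew_weight n al nu = [multinom (if i \in S then k else 0)%N | i < n].
    by apply/mnmP => i; rewrite !mnmE inS addKn.
  exact: mcoeff_schur_rect.
move=> s h1 h2.
have hk : (head 0 (nseq b k) <= k)%N by case: (b).
have shS (i : 'I_n) : (shifted n nu i = shifted n al i + (if i \in S then k else 0))%N.
  by rewrite /shifted inS addnAC.
have down i : i \in S -> (s i <= i)%N.
  move=> iS; rewrite -(@shifted_le n al) //.
  by have := h2 i; rewrite shS iS; lia.
have up i : i \notin S -> (i <= s i)%N.
  move=> iS; rewrite -(@shifted_le n al) //.
  by have := h1 i; rewrite shS (negPf iS) addn0.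
have stab i : i \in S -> s i \in S.
  move=> iS; have := down i iS; rewrite leq_eqVlt => /orP[/eqP/val_inj -> //|lt].
  apply/negPn/negP => nS.
  have eS : shifted n nu (s i) = shifted n al (s i) by rewrite shS (negPf nS) addn0.
  by have := h1 i; rewrite -eS (@shifted_le n nu) // leqNgt lt.
have fixS i : i \in S -> s i = i.
  move e: (nat_of_ord i) => m; elim/ltn_ind: m i e => m IH i e iS.
  apply/val_inj/eqP; have := down i iS; rewrite leq_eqVlt => /orP[//|lt].
  have /perm_inj e' : s (s i) = s i by apply: (IH (s i)); rewrite -?e ?stab.
  by rewrite e' ltnn in lt.
apply: perm_ge_id => i; case: (boolP (i \in S)) => [iS|]; last exact: up.
by rewrite fixS.
Qed.

(** * Intervals of the Young lattice and the saturation argument *)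

(** Boxes of [up] outside [lo] are removed one at a time, from the last row where
[lo] and [up] differ. *)
Lemma young_interval (n a : nat) (lo up : nat -> nat) :
  (forall i, (lo i.+1 <= lo i)%N) -> (forall i, (up i.+1 <= up i)%N) ->
  (forall i, (lo i <= up i)%N) ->
  (\sum_(i < n) lo i <= a <= \sum_(i < n) up i)%N ->
  exists t : nat -> nat, [/\ forall i, (i.+1 < n)%N -> (t i.+1 <= t i)%N,
    forall i, (lo i <= t i <= up i)%N & (\sum_(i < n) t i = a)%N].
Proof.
move=> nlo.
move e: (\sum_(i < n) up i - a)%N => d; elim: d up e => [|d IH] up e nup le /andP[h1 h2].
  exists up; split=> [//|i|]; first by rewrite le leqnn.
  by apply/eqP; rewrite eqn_leq h2 andbT -subn_eq0 e.
have /existsP[i0 hi0] : [exists i : 'I_n, (lo i < up i)%N].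
  rewrite -[X in is_true X]negbK negb_exists; apply/negP => /forallP h.
  suff : (\sum_(i < n) up i <= \sum_(i < n) lo i)%N by lia.
  by apply: leq_sum => i _; have := h i; rewrite -leqNgt.
have [i hi imax] := @arg_maxnP _ i0 (fun i : 'I_n => (lo i < up i)%N) (fun i => nat_of_ord i) hi0.
pose up' j := if j == i :> nat then (up i).-1 else up j.
have sum_up : (\sum_(j < n) up j = (\sum_(j < n) up' j).+1)%N.
  rewrite (bigD1 i) // [in RHS](bigD1 i) //=.
  have -> : up' i = (up i).-1 by rewrite /up' eqxx.
  rewrite [in RHS](eq_bigr (fun j : 'I_n => up j)); first by have := hi; lia.
  by move=> j /negPf; rewrite -val_eqE /up' => /= ->.
(* The sums only see the rows before n; from row n on, the bound is lowered to lo
   to remain nonincreasing. *)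
pose up2 j := if (j < n)%N then up' j else lo j.
have lo_up2 j : (lo j <= up2 j)%N.
  rewrite /up2 /up'; case: ltnP => // _; case: eqP => [->|_]; last exact: le.
  by have := hi; lia.
have sum_up2 : (\sum_(j < n) up2 j = \sum_(j < n) up' j)%N.
  by apply: eq_bigr => j _; rewrite /up2 ltn_ord.
have up2_ni j : (up2 j.+1 <= up2 j)%N.
  rewrite /up2; case: (ltnP j.+1 n) => [lt|ge]; last first.
    by apply: leq_trans (nlo j) _; have := lo_up2 j; rewrite /up2.
  rewrite (ltnW lt) /up'; case: (eqVneq j i) => [ej|nj].
    rewrite ej gtn_eqF //.
    have : (up i.+1 <= lo i.+1)%N.
      rewrite leqNgt; apply/negP => gt; rewrite -ej in gt.
      by have := imax (Ordinal lt) gt; rewrite /= ej ltnn.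
    by have := nlo i; have := hi; lia.
  case: eqP => [ej|_]; last exact: nup.
  by apply: leq_trans (leq_pred _) _; rewrite -ej; apply: nup.
have [||t [h4 h5 h6]] := IH up2 _ up2_ni lo_up2.
- by rewrite sum_up2; lia.
- by rewrite sum_up2; lia.
exists t; split=> // j; have /andP[-> h7] := h5 j.
apply: leq_trans h7 _; rewrite /up2 /up'; case: ltnP => _; last exact: le.
by case: eqP => [->|//]; apply: leq_pred.
Qed.

Lemma young_interval_scaled (n k a : nat) (al : seq nat) (lo up : nat -> nat) :
  (0 < k)%N -> (size al <= n)%N -> sumn al = (k * a)%N ->
  (forall i, (lo i.+1 <= lo i)%N) -> (forall i, (up i.+1 <= up i)%N) ->
  (forall i, (n <= i)%N -> up i = 0%N) ->
  (forall i, (k * lo i <= nth 0 al i <= k * up i)%N) ->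
  exists al', [/\ is_part al', sumn al' = a &
    forall i, (lo i <= nth 0 al' i <= up i)%N].
Proof.
move=> k0 sa ea nlo nup up0 h.
have le i : (lo i <= up i)%N.
  by have /andP[h1 h2] := h i; rewrite -(leq_pmul2l k0); apply: leq_trans h2.
have [|t [t1 t2 t3]] := @young_interval n a lo up nlo nup le.
  rewrite -(leq_pmul2l k0) -[X in _ && X](leq_pmul2l k0) !big_distrr /= -ea (sumn_nth sa).
  by apply/andP; split; apply: leq_sum => i _; have /andP[] := h i.
have [p1 p2 p3] := trimP t1.
exists (trim n t); split=> //.
  by rewrite (sumn_nth p2) -t3; apply: eq_bigr => i _; apply: p3.
move=> i; case: (ltnP i n) => [lt|ge]; first by rewrite p3.
have := le i; rewrite up0 // leqn0 => /eqP ->.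
by rewrite nth_default // (leq_trans p2).
Qed.

(** The three scaled Littlewood-Richardson coefficients are positive, which is
stronger than the positivity of their product. *)
Definition saturated_triple k (mu nu la : seq nat) :=
  exists al be ga : seq nat,
    [/\ is_part al, is_part be, is_part ga &
     [/\ 0 < LR (scale k al) (scale k be) (scale k mu),
         0 < LR (scale k al) (scale k ga) (scale k nu) &
         0 < LR (scale k be) (scale k ga) (scale k la)]].

Lemma halve_sizes (k A B G L M N : nat) : (0 < k)%N ->
  (L + M + N)%N = 0%N %[mod 2] ->
  (k * M = A + B)%N -> (k * N = A + G)%N -> (k * L = B + G)%N ->
  exists a, [/\ A = (k * a)%N, (a <= M)%N, (a <= N)%N & (M - a + (N - a) = L)%N].
Proof.
move=> k0 ev e1 e2 e3.
have le : (L <= M + N)%N by rewrite -(leq_pmul2l k0) mulnDr; lia.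
pose a := ((M + N - L) %/ 2)%N.
have ea : (a + a + L = M + N)%N by rewrite /a; lia.
have eA : A = (k * a)%N.
  have : (k * (a + a + L) = k * (M + N))%N by rewrite ea.
  by rewrite !mulnDr; lia.
have l1 : (a <= M)%N by rewrite -(leq_pmul2l k0); lia.
have l2 : (a <= N)%N by rewrite -(leq_pmul2l k0); lia.
by exists a; split=> //; lia.
Qed.

Lemma leq_maxn2 a b c d : (a <= c)%N -> (b <= d)%N -> (maxn a b <= maxn c d)%N.
Proof. by move=> h1 h2; rewrite geq_max !leq_max h1 h2 orbT. Qed.

Lemma leq_minn2 a b c d : (a <= c)%N -> (b <= d)%N -> (minn a b <= minn c d)%N.
Proof. by move=> h1 h2; rewrite leq_min !geq_min h1 h2 orbT. Qed.

Section Saturation.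
Variables (k : nat) (la mu nu al be ga : seq nat).
Hypotheses (k0 : (0 < k)%N) (pla : is_part la) (pmu : is_part mu) (pnu : is_part nu).
Hypotheses (pal : is_part al) (pbe : is_part be) (pga : is_part ga).
Hypothesis even_sum : (sumn la + sumn mu + sumn nu)%N = 0%N %[mod 2].
Hypothesis hmu : LR al be (scale k mu) != 0.
Hypothesis hnu : LR al ga (scale k nu) != 0.
Hypothesis hla : LR be ga (scale k la) != 0.

Let skmu : is_part (scale k mu) := scale_part k0 pmu.
Let sknu : is_part (scale k nu) := scale_part k0 pnu.
Let skla : is_part (scale k la) := scale_part k0 pla.

Lemma size_split : exists a, [/\ sumn al = (k * a)%N, (a <= sumn mu)%N, (a <= sumn nu)%N &
  (sumn mu - a + (sumn nu - a) = sumn la)%N].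
Proof.
have e1 := LR_sumn pal pbe skmu hmu; have e2 := LR_sumn pal pga sknu hnu.
have e3 := LR_sumn pbe pga skla hla; rewrite !sumn_scale in e1 e2 e3.
exact: halve_sizes k0 even_sum e1 e2 e3.
Qed.

Let be_le i : (nth 0 be i <= k * nth 0 la i)%N.
Proof. by have /andP[] := LR_bounds pbe pga skla hla i; rewrite scale_nth. Qed.

Let ga_le i : (nth 0 ga i <= k * nth 0 la i)%N.
Proof.
have h : LR ga be (scale k la) != 0 by rewrite LR_sym.
by have /andP[] := LR_bounds pga pbe skla h i; rewrite scale_nth.
Qed.

Let al_mu i : (nth 0 al i <= k * nth 0 mu i <= nth 0 al i + head 0 be)%N.
Proof. by have := LR_bounds pal pbe skmu hmu i; rewrite scale_nth. Qed.

Let al_nu i : (nth 0 al i <= k * nth 0 nu i <= nth 0 al i + head 0 ga)%N.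
Proof. by have := LR_bounds pal pga sknu hnu i; rewrite scale_nth. Qed.

Let n := (size mu + size nu + size al)%N.

Let nth_mu0 i : (n <= i)%N -> nth 0%N mu i = 0%N.
Proof. by move=> le; rewrite nth_default // (leq_trans _ le) // /n -addnA leq_addr. Qed.

Lemma row_saturation : single_row la -> saturated_triple k mu nu la.
Proof.
case=> t ela.
have [a [ea amu anu ela']] := size_split.
have size1 s : is_part s -> (forall i, (nth 0 s i <= k * nth 0 la i)%N) -> (size s <= 1)%N.
  move=> ps h; rewrite leqNgt -(nth_part_gt0 _ ps) -leqNgt.
  by apply: leq_trans (h 1%N) _; rewrite ela /= muln0.
have st1 := LR_row_strip pal pbe skmu (size1 _ pbe be_le) hmu.
have st2 := LR_row_strip pal pga sknu (size1 _ pga ga_le) hnu.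
have sa : (size al <= n)%N by apply: leq_addl.
have mu_ni i : (nth 0 mu i.+1 <= nth 0 mu i)%N by apply: nth_part_noninc.
have nu_ni i : (nth 0 nu i.+1 <= nth 0 nu i)%N by apply: nth_part_noninc.
have [|||i|al' [pal' sal' hal']] := @young_interval_scaled n k a al
  (fun i => maxn (nth 0 mu i.+1) (nth 0 nu i.+1))%N
  (fun i => minn (nth 0 mu i) (nth 0 nu i))%N k0 sa ea.
- by move=> i; apply: leq_maxn2.
- by move=> i; apply: leq_minn2.
- by move=> i le; rewrite nth_mu0 // min0n.
- rewrite maxnMr minnMr geq_max leq_min -!scale_nth st1 st2 /=.
  by rewrite !scale_nth; have /andP[-> _] := al_mu i; have /andP[-> _] := al_nu i.
have hal i : [/\ nth 0 mu i.+1 <= nth 0 al' i, nth 0 nu i.+1 <= nth 0 al' i,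
    nth 0 al' i <= nth 0 mu i & nth 0 al' i <= nth 0 nu i]%N.
  by have := hal' i; rewrite geq_max leq_min => /andP[/andP[-> ->] /andP[-> ->]].
(* The row of b boxes, without a zero part when b = 0. *)
pose row (b : nat) : seq nat := nseq (0 < b)%N b.
have row_part b : is_part (row b).
  by case: b => // b; rewrite /row /is_part.
have row_sum b : sumn (row b) = b by case: b => //= b; rewrite addn0.
have row_size b : (size (scale k (row b)) <= 1)%N by rewrite size_map size_nseq; case: b.
have row_nth b i : nth 0%N (row b) i = if i == 0%N then b else 0%N.
  by case: b => [|b]; case: i => [|i] //=; rewrite nth_nil.
exists al', (row (sumn mu - a)%N), (row (sumn nu - a)%N); split; rewrite ?row_part //.
split; apply: LR_row_pos; rewrite ?scale_part //.
- by rewrite !sumn_scale row_sum sal' -mulnDr subnKC.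
- by move=> i; rewrite !scale_nth leq_pmul2l //; case: (hal i).
- by move=> i; rewrite !scale_nth leq_pmul2l //; case: (hal i).
- by rewrite !sumn_scale row_sum sal' -mulnDr subnKC.
- by move=> i; rewrite !scale_nth leq_pmul2l //; case: (hal i).
- by move=> i; rewrite !scale_nth leq_pmul2l //; case: (hal i).
- by rewrite !sumn_scale !row_sum -mulnDr ela'.
- move=> i; rewrite !scale_nth row_nth leq_pmul2l //; case: eqP => // ->.
  by move: ela'; rewrite ela /= addn0 => <-; apply: leq_addr.
- by move=> i; rewrite !scale_nth ela /= nth_nil muln0.
Qed.

Lemma column_saturation : single_column la -> saturated_triple k mu nu la.
Proof.
case=> t ela.
have [a [ea amu anu ela']] := size_split.
have head_le s : (forall i, (nth 0 s i <= k * nth 0 la i)%N) -> (head 0 s <= k)%N.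
  move=> h; rewrite -nth0; apply: leq_trans (h 0%N) _.
  by rewrite ela nth_nseq; case: ifP; rewrite ?muln1 ?muln0.
have hb := head_le _ be_le; have hg := head_le _ ga_le.
have sa : (size al <= n)%N by apply: leq_addl.
have mu_ni i : (nth 0 mu i.+1 <= nth 0 mu i)%N by apply: nth_part_noninc.
have nu_ni i : (nth 0 nu i.+1 <= nth 0 nu i)%N by apply: nth_part_noninc.
have [|||i|al' [pal' sal' hal']] := @young_interval_scaled n k a al
  (fun i => (maxn (nth 0 mu i) (nth 0 nu i)).-1)%N
  (fun i => minn (nth 0 mu i) (nth 0 nu i))%N k0 sa ea.
- by move=> i; rewrite -!subn1 leq_sub2r // leq_maxn2.
- by move=> i; apply: leq_minn2.
- by move=> i le; rewrite nth_mu0 // min0n.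
- have /andP[m1 m2] := al_mu i; have /andP[n1 n2] := al_nu i.
  rewrite minnMr leq_min m1 n1 andbT -subn1 mulnBr muln1 leq_subLR maxnMr geq_max addnC.
  by rewrite (leq_trans m2) ?(leq_trans n2) // leq_add2l.
have hal i : [/\ (nth 0 mu i).-1 <= nth 0 al' i, (nth 0 nu i).-1 <= nth 0 al' i,
    nth 0 al' i <= nth 0 mu i & nth 0 al' i <= nth 0 nu i]%N.
  have := hal' i; rewrite leq_min => /andP[h /andP[-> ->]].
  by split=> //; apply: leq_trans h; rewrite -!subn1 leq_sub2r // ?leq_maxl ?leq_maxr.
have scale_col b : scale k (nseq b 1%N) = nseq b k by rewrite /scale map_nseq muln1.
exists al', (nseq (sumn mu - a)%N 1%N), (nseq (sumn nu - a)%N 1%N).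
split; rewrite ?is_part_nseq // !scale_col.
have dich s i : ((nth 0 s i).-1 <= nth 0 al' i <= nth 0 s i)%N ->
    (nth 0 (scale k s) i = nth 0 (scale k al') i \/
     nth 0 (scale k s) i = nth 0 (scale k al') i + k)%N.
  move=> h; rewrite !scale_nth.
  have [->|->] : nth 0%N s i = nth 0%N al' i \/ nth 0%N s i = (nth 0%N al' i).+1.
    by move: h; clear; lia.
    by left.
  by right; rewrite mulnS addnC.
split; apply: LR_rect_pos; rewrite ?scale_part ?is_part_nseq //.
- by rewrite !sumn_scale sal' [(_ * k)%N]mulnC -mulnDr subnKC.
- by move=> i; apply: dich; have [] := hal i; move=> -> _ -> _.
- by rewrite !sumn_scale sal' [(_ * k)%N]mulnC -mulnDr subnKC.
- by move=> i; apply: dich; have [] := hal i; move=> _ -> _ ->.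
- by rewrite sumn_scale sumn_nseq [X in (_ + X)%N]mulnC -mulnDr ela'.
move=> i; rewrite ela scale_col !nth_nseq.
have : (sumn mu - a <= t)%N by rewrite -[t]mul1n -sumn_nseq -ela -ela' leq_addr.
move=> le_t; case: (ltnP i (sumn mu - a)) => [lt|_]; first by rewrite (leq_trans lt le_t); left.
by case: ifP => _; [right|left].
Qed.

Lemma saturation : single_row la \/ single_column la -> saturated_triple k mu nu la.
Proof. by case; [apply: row_saturation|apply: column_saturation]. Qed.

End Saturation.

Lemma newell_littlewood_neq0 (mu nu la : seq nat) : newell_littlewood mu nu la != 0 ->
  exists al be ga, [/\ is_part al, is_part be, is_part ga &
    [/\ LR al be mu != 0, LR al ga nu != 0 & LR be ga la != 0]].
Proof.
move=> nz; apply: boolp.contrapT => none; case/eqP: nz.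
apply: fsbigop.fsbig1 => -[[al be] ga] [pa pb pg].
apply/eqP/negPn/negP; rewrite !mulf_eq0 !negb_or => /andP[/andP[h1 h2] h3].
by apply: none; exists al, be, ga.
Qed.

Theorem theorem5p7 (la mu nu : seq nat)
  (hla : is_part la) (hmu : is_part mu) (hnu : is_part nu)
  (heven : (sumn la + sumn mu + sumn nu)%N = 0%N %[mod 2])
  (hone : (single_row la \/ single_column la) \/
          (single_row mu \/ single_column mu) \/
          (single_row nu \/ single_column nu))
  (k : nat) (hk : (1 <= k)%N)
  (hN : 0 < newell_littlewood (scale k mu) (scale k nu) (scale k la)) :
  exists al be ga : seq nat,
    [/\ is_part al, is_part be, is_part ga &
        0 < LR (scale k al) (scale k be) (scale k mu) *
            LR (scale k al) (scale k ga) (scale k nu) *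
            LR (scale k be) (scale k ga) (scale k la)].
Proof.
have [al [be [ga [pa pb pg [h1 h2 h3]]]]] := newell_littlewood_neq0 (lt0r_neq0 hN).
have sk s : is_part s -> is_part (scale k s) by apply: scale_part.
have h1' : LR be al (scale k mu) != 0 by rewrite LR_sym ?sk.
have h2' : LR ga al (scale k nu) != 0 by rewrite LR_sym ?sk.
have h3' : LR ga be (scale k la) != 0 by rewrite LR_sym ?sk.
case: hone => [one|[one|one]].
- have [al' [be' [ga' [pa' pb' pg' [g1 g2 g3]]]]] :=
    saturation hk hla hmu hnu pa pb pg heven h1 h2 h3 one.
  by exists al', be', ga'; split=> //; rewrite !mulr_gt0.
(* The partition shared by the other two factors plays the role of al. *)
- have ev : (sumn mu + sumn nu + sumn la)%N = 0%N %[mod 2] by rewrite -heven; congr (_ %% _)%N; lia.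
  have [ga' [al' [be' [pg' pa' pb' [g1 g2 g3]]]]] :=
    saturation hk hmu hnu hla pg pa pb ev h2' h3' h1 one.
  exists al', be', ga'; split=> //.
  by rewrite (LR_sym (sk _ pa') (sk _ pg')) ?(LR_sym (sk _ pb') (sk _ pg')) ?sk // !mulr_gt0.
have ev : (sumn nu + sumn mu + sumn la)%N = 0%N %[mod 2] by rewrite -heven; congr (_ %% _)%N; lia.
have [be' [al' [ga' [pb' pa' pg' [g1 g2 g3]]]]] :=
  saturation hk hnu hmu hla pb pa pg ev h1' h3 h2 one.
exists al', be', ga'; split=> //.
by rewrite (LR_sym (sk _ pa') (sk _ pb')) ?sk // !mulr_gt0.
Qed.
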